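(* Suppose that the process $X$ possesses a transition probability density $p_t(x,y)$ that is differentiable with respect to $t$ and satisfies the estimates $$p_t(x,y)\le C_T\,t^{-d/\alpha}\,Q\bigl(t^{-1/\alpha}(x-y)\bigr),\quad t\le T,$$ $$\bigl|\partial_t p_t(x,y)\bigr|\le C_T\,t^{-1-d/\alpha}\,Q\bigl(t^{-1/\alpha}(x-y)\bigr),\quad t\le T,$$ $$\bigl|\partial^2_{tt} p_t(x,y)\bigr|\le C_T\,t^{-2-d/\alpha}\,Q\bigl(t^{-1/\alpha}(x-y)\bigr),\quad t\le T,$$ for some fixed $\alpha\in(0,2]$ and some distribution density $Q$ on $\mathbb{R}^d$ such that $\int_{\mathbb{R}^d}|z|^{2\gamma}Q(z)\,dz<\infty$, where (without loss of generality) $C_T\ge 1$. Suppose that the function $h$ satisfies the Hölder condition with exponent $\gamma\in(0,\alpha/2]$, that is, $$\|h\|_\gamma:=\sup_{x\ne y}\frac{|h(x)-h(y)|}{|x-y|^\gamma}<\infty.$$ Then $$\mathbb{E}_x\bigl|I_T(h)-I_{T,n}(h)\bigr|^2\le\begin{cases}D_{T,\gamma,\alpha,Q}\,C_{\gamma,\alpha}\,\|h\|_\gamma^2\,n^{-(1+2\gamma/\alpha)},&\gamma\ne\alpha/2,\\ D_{T,\gamma,\alpha,Q}\,\|h\|_\gamma^2\,n^{-2}\ln n,&\gamma=\alpha/2,\end{cases}$$ where $$D_{T,\gamma,\alpha,Q}=8\,C_T^2\,T^{2+2\gamma/\alpha}\int_{\mathbb{R}^d}|z|^{2\gamma}Q(z)\,dz,$$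 $$C_{\gamma,\alpha}=\max\Bigl\{(1-2\gamma/\alpha)^{-1}(2\gamma/\alpha)^{-1},\ \max_{n\ge1}\Bigl(\frac{(\ln n)^2}{n^{1-2\gamma/\alpha}}\Bigr)\Bigr\}.$$
   Context: $X_t$, $t\ge0$, is a Markov process with values in $\mathbb{R}^d$, and $h$ is a real-valued function on $\mathbb{R}^d$. The integral functional of the process and the sequence of its integral sums are $$I_T(h)=\int_0^T h(X_t)\,dt,\qquad I_{T,n}(h)=\frac{T}{n}\sum_{k=0}^{n-1}h\bigl(X_{(kT)/n}\bigr),\quad n\ge1.$$ $P_x$ denotes the law of the Markov process $X$ conditioned by $X_0=x$, and $\mathbb{E}_x$ denotes the expectation with respect to this law. Both the absolute value of a real number and the Euclidean norm in $\mathbb{R}^d$ are denoted by $|\cdot|$.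
   Formalization: The case γ = α/2 is proved for n ≥ 2 only: at n = 1 the stated bound is 0 because ln 1 = 0, and it fails, e.g. for Brownian motion with h(x) = x, α = 2, γ = 1, where the left side is T³/3. *)

(* Defs.v *)
(* The reals are an arbitrary R : realType, and R^d is the type 'rV[R]_d. *)
From HB Require Import structures.
From mathcomp Require Import all_boot all_order all_algebra.
From mathcomp Require Import all_classical all_reals all_analysis.
From mathcomp Require Import measurable_realfun.

Set Implicit Arguments.
Unset Strict Implicit.
Unset Printing Implicit Defensive.

Import Order.TTheory GRing.Theory Num.Theory.
Import numFieldNormedType.Exports.

Local Open Scope classical_set_scope.
Local Open Scope ring_scope.

Definition measure_rV_display : measure_display.
Proof. exact: default_measure_display. Qed.

(* The Borel sigma-algebra of R^n, as the sigma-algebra generated by the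
   coordinate maps (same construction as the library's one on n.-tuple T). *)
Section measurable_rV.
Context {R : realType} (n : nat).

Let coord_rV : 'I_n -> 'rV[R]_n -> R := fun i x => x ord0 i.

Let rV_set0 : g_sigma_preimage coord_rV set0.
Proof. exact: sigma_algebra0. Qed.

Let rV_setC A : g_sigma_preimage coord_rV A -> g_sigma_preimage coord_rV (~` A).
Proof. exact: sigma_algebraC. Qed.

Let rV_bigcup (F : _^nat) : (forall i, g_sigma_preimage coord_rV (F i)) ->
  g_sigma_preimage coord_rV (\bigcup_i (F i)).
Proof. exact: sigma_algebra_bigcup. Qed.

HB.instance Definition _ := @isMeasurable.Build measure_rV_display
  'rV[R]_n (g_sigma_preimage coord_rV) rV_set0 rV_setC rV_bigcup.

End measurable_rV.


Section measurable_rV_theory.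
Context {R : realType}.

Lemma measurable_coord_rV n (i : 'I_n) :
  measurable_fun [set: 'rV[R]_n] (fun x => x ord0 i).
Proof.
move=> _ Y mY; rewrite setTI; apply: sub_sigma_algebra => /=.
rewrite -bigcup_seq/=; exists i => /=; first by rewrite mem_index_enum.
by exists Y => //; rewrite setTI.
Qed.

Lemma measurable_fun_rVP d (T : measurableType d) n (f : T -> 'rV[R]_n) :
  measurable_fun setT f <-> forall i, measurable_fun setT (fun w => f w ord0 i).
Proof.
split=> [mf i|mf].
  exact: (measurableT_comp (measurable_coord_rV i) mf).
apply: (@iffRL _ (g_sigma_preimage
    (fun i => (fun x : 'rV[R]_n => x ord0 i) \o f) `<=` measurable)).
  rewrite g_sigma_preimage_comp; split=> [mf' A [/= C preC <-]|prefS].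
    exact: mf'.
  by move=> _ A mA; apply: prefS; exists A.
apply: smallest_sub; first exact: sigma_algebra_measurable.
case: n => [|n] in f mf *; first by rewrite big_ord0.
rewrite -bigcup_mkord_ord; apply: bigcup_sub => i Ii.
by move=> A [B mB <-]; exact: mf.
Qed.

End measurable_rV_theory.

(* From a measure m on R^n, the measure (Lebesgue on R) x m on R^(n+1), the
   first coordinate being the new one. *)
Section cons_measure.
Context {R : realType} (n : nat).
Variable m : {sigma_finite_measure set 'rV[R]_n -> \bar R}.

Definition cons_rV (z : R * 'rV[R]_n) : 'rV[R]_n.+1 :=
  \row_i (if unlift ord0 i is Some j then z.2 ord0 j else z.1).

Definition uncons_rV (x : 'rV[R]_n.+1) : R * 'rV[R]_n :=
  (x ord0 ord0, \row_j x ord0 (lift ord0 j)).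

Lemma cons_rVK : cancel cons_rV uncons_rV.
Proof.
move=> [t x]; rewrite /uncons_rV mxE unlift_none; congr pair.
by apply/rowP => j; rewrite !mxE liftK.
Qed.

Lemma uncons_rVK : cancel uncons_rV cons_rV.
Proof.
by move=> x; apply/rowP => i; rewrite mxE; case: unliftP => [j|] ->; rewrite ?mxE.
Qed.

Lemma measurable_cons_rV : measurable_fun setT cons_rV.
Proof.
apply/measurable_fun_rVP => i; rewrite /cons_rV.
under eq_fun do rewrite mxE.
case: unliftP => [j|] _; last exact: measurable_fst.
exact: (measurableT_comp (measurable_coord_rV j)).
Qed.

Lemma measurable_uncons_rV : measurable_fun setT uncons_rV.
Proof.
apply: measurable_fun_pair; first exact: measurable_coord_rV.
apply/measurable_fun_rVP => i; under eq_fun do rewrite mxE.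
exact: measurable_coord_rV.
Qed.

Definition cons_measure : set 'rV[R]_n.+1 -> \bar R :=
  pushforward (@lebesgue_measure R \x m)%E cons_rV.

Let cons_measure0 : cons_measure set0 = 0%E.
Proof. by rewrite /cons_measure /pushforward preimage_set0 measure0. Qed.

Let cons_measure_ge0 A : (0 <= cons_measure A)%E.
Proof. by rewrite /cons_measure /pushforward; exact: measure_ge0. Qed.

Let cons_measure_sigma_additive : semi_sigma_additive cons_measure.
Proof.
have mpre A : measurable A -> measurable (cons_rV @^-1` A).
  by move=> mA; rewrite -[X in measurable X]setTI; exact: measurable_cons_rV.
move=> F mF tF mUF; rewrite /cons_measure /pushforward preimage_bigcup.
apply: measure_semi_sigma_additive.
- by move=> k; exact: mpre.
- apply/trivIsetP => /= i j _ _ ij; rewrite -preimage_setI.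
  by move/trivIsetP : tF => /(_ _ _ _ _ ij) ->//; rewrite preimage_set0.
- by rewrite -preimage_bigcup; exact: mpre.
Qed.

HB.instance Definition _ := isMeasure.Build _ _ _ cons_measure
  cons_measure0 cons_measure_ge0 cons_measure_sigma_additive.

Let cons_measure_sigma_finite : sigma_finite setT cons_measure.
Proof.
have /sigma_finiteP[F [TF ndF Foo]] := sigma_finiteT (@lebesgue_measure R).
have /sigma_finiteP[G [TG ndG Goo]] := sigma_finiteT m.
exists (fun k => uncons_rV @^-1` (F k `*` G k)).
  rewrite -preimage_bigcup [X in _ @^-1` X](_ : _ = setT) ?preimage_setT//.
  rewrite -setXTT TF TG predeqE => -[x y]; split.
    by move=> [k _ []/= ? ?]; split; exists k.
  move=> [/= [k _ Fkx] [l _ Gly]]; exists (maxn k l) => //; split.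
  - by move: x Fkx; exact/subsetPset/ndF/leq_maxl.
  - by move: y Gly; exact/subsetPset/ndG/leq_maxr.
move=> k; have [? ?] := Foo k; have [? ?] := Goo k; split.
  rewrite -[X in measurable X]setTI; apply: measurable_uncons_rV => //.
  exact: measurableX.
rewrite /cons_measure /pushforward -comp_preimage.
rewrite (_ : uncons_rV \o cons_rV = id); last by apply/funext => z; exact: cons_rVK.
by rewrite product_measure1E// lte_mul_pinfty// ge0_fin_numE.
Qed.

HB.instance Definition _ := Measure_isSigmaFinite.Build _ _ _ cons_measure
  cons_measure_sigma_finite.

End cons_measure.

Fixpoint lebesgue_rV {R : realType} (n : nat) :
    {sigma_finite_measure set 'rV[R]_n -> \bar R} :=
  match n with
  | 0 => dirac (0 : 'rV[R]_0)
  | k.+1 => cons_measure (lebesgue_rV k)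
  end.

Lemma measurable_box_rV {R : realType} n (a b : 'rV[R]_n) :
  measurable [set x : 'rV[R]_n | forall i, a ord0 i <= x ord0 i <= b ord0 i].
Proof.
rewrite (_ : mkset _ = \bigcap_(i in [set: 'I_n])
    ((fun x : 'rV[R]_n => x ord0 i) @^-1` `[a ord0 i, b ord0 i]%classic)).
  apply: fin_bigcap_measurable => [|i _]; first exact: finite_finset.
  by rewrite -[X in measurable X]setTI; exact: measurable_coord_rV.
apply/seteqP; split=> [x xab i _|x xab i] /=; first by rewrite in_itv /= xab.
by have := xab i I; rewrite /= in_itv.
Qed.

(* lebesgue_rV n is the Lebesgue measure of R^n *)
Lemma lebesgue_rV_box {R : realType} n (a b : 'rV[R]_n) :
  (forall i, a ord0 i <= b ord0 i) ->
  lebesgue_rV n [set x | forall i, a ord0 i <= x ord0 i <= b ord0 i] =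
  (\prod_(i < n) (b ord0 i - a ord0 i))%:E.
Proof.
elim: n a b => [|n IH] a b ab.
  by rewrite big_ord0 /= diracE mem_set//=; case.
pose a' := (uncons_rV a).2; pose b' := (uncons_rV b).2.
pose B := [set x : 'rV[R]_n | forall i, a' ord0 i <= x ord0 i <= b' ord0 i].
have IHB : lebesgue_rV n B = (\prod_(i < n) (b' ord0 i - a' ord0 i))%:E.
  by apply: IH => i; rewrite !mxE.
have -> : \prod_(i < n.+1) (b ord0 i - a ord0 i) =
    (b ord0 ord0 - a ord0 ord0) * \prod_(i < n) (b' ord0 i - a' ord0 i).
  by rewrite big_ord_recl; congr (_ * _); apply: eq_bigr => i _; rewrite !mxE.
rewrite EFinM -IHB.
have -> : (b ord0 ord0 - a ord0 ord0)%:E =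
    lebesgue_measure `[a ord0 ord0, b ord0 ord0]%classic.
  rewrite lebesgue_measure_itv/= lte_fin; have [//|ba] := ltP.
  by have /le_anti -> : a ord0 ord0 <= b ord0 ord0 <= a ord0 ord0;
    rewrite ?ab ?ba ?subrr.
rewrite -product_measure1E//; last exact: measurable_box_rV.
rewrite /= /cons_measure /pushforward; congr product_measure1.
apply/seteqP; split=> [[t x] xab|[t x] [/= + xab] i] /=.
  split=> /=.
    by have := xab ord0; rewrite /cons_rV mxE unlift_none in_itv.
  by move=> i; have := xab (lift ord0 i); rewrite /cons_rV !mxE liftK.
rewrite in_itv /= => tab; rewrite /cons_rV mxE; case: unliftP => [j ->|->] //=.
by have := xab j; rewrite !mxE.
Qed.

Section vocabulary.
Context {R : realType}.

(* The library's norm on 'rV[R]_d is the sup norm. *)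
Definition enorm d (x : 'rV[R]_d) : R := Num.sqrt (\sum_(i < d) x ord0 i ^+ 2).

Definition holder_seminorm d (gamma : R) (h : 'rV[R]_d -> R) : \bar R :=
  ereal_sup [set (`|h xy.1 - h xy.2| / enorm (xy.1 - xy.2) `^ gamma)%:E
            | xy in [set xy : 'rV[R]_d * 'rV[R]_d | xy.1 != xy.2]].

Definition is_density d (Q : 'rV[R]_d -> R) : Prop :=
  [/\ measurable_fun setT Q, (forall z, 0 <= Q z) &
      (\int[lebesgue_rV d]_z (Q z)%:E = 1)%E].

Definition moment d (Q : 'rV[R]_d -> R) (r : R) : \bar R :=
  (\int[lebesgue_rV d]_z (enorm z `^ r * Q z)%:E)%E.

(* Time is R, but only the X t with t >= 0 are constrained or used. *)
Section process.
Context (d : nat) (dO : measure_display) (Omega : measurableType dO).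
Implicit Types (X : R -> Omega -> 'rV[R]_d) (P : 'rV[R]_d -> probability Omega R).

Definition measurable_process X : Prop :=
  measurable_fun [set z : R * Omega | 0 <= z.1]
    (fun z : R * Omega => X z.1 z.2).

Definition natural_filtration X (s : R) : set (set Omega) :=
  <<s \bigcup_(u in `[0, s]%classic) preimage_set_system setT (X u) measurable >>.

(* The last field says that the function w |-> P_(X s w) (X t \in B), which is
   sigma(X s)-measurable by the fourth, is a version of the conditional
   probability P_x (X (s + t) \in B | F_s), F the natural filtration of X. *)
Record markov_process X P : Prop := MarkovProcess {
  markov_measurable : forall t : R, 0 <= t -> measurable_fun setT (X t) ;
  markov_joint_measurable : measurable_process X ;
  markov_start : forall x, P x [set w | X 0 w = x] = 1%E ;
  markov_kernel : forall (t : R) (B : set 'rV[R]_d),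
    0 <= t -> measurable B ->
    measurable_fun setT (fun x => P x (X t @^-1` B) : \bar R) ;
  markov_property : forall x (s t : R) (A : set Omega) (B : set 'rV[R]_d),
    0 <= s -> 0 <= t ->
    natural_filtration X s A -> measurable B ->
    P x (A `&` X (s + t) @^-1` B) =
    (\int[P x]_(w in A) P (X s w) (X t @^-1` B))%E }.

Definition transition_density X P (p : R -> 'rV[R]_d -> 'rV[R]_d -> R) : Prop :=
  forall t, 0 < t ->
  [/\ measurable_fun setT (fun z : 'rV[R]_d * 'rV[R]_d => p t z.1 z.2),
      (forall x y, 0 <= p t x y) &
      forall x B, measurable B ->
        P x (X t @^-1` B) = (\int[lebesgue_rV d]_(y in B) (p t x y)%:E)%E].

Definition integral_functional X (h : 'rV[R]_d -> R) (T : R) (w : Omega) : R :=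
  \int[lebesgue_measure]_(t in `[0, T]) h (X t w).

Definition integral_functional_sum X (h : 'rV[R]_d -> R) (T : R) (n : nat) (w : Omega) : R :=
  T / n%:R * \sum_(k < n) h (X (k%:R * T / n%:R) w).

End process.

Definition D_const d (T gamma alpha : R) (Q : 'rV[R]_d -> R) (CT : R) : R :=
  8 * CT ^+ 2 * T `^ (2 + 2 * gamma / alpha) * fine (moment Q (2 * gamma)).

(* When 2 gamma / alpha < 1 the supremum below is attained, so it is the
   maximum over n >= 1. *)
Definition C_const (gamma alpha : R) : R :=
  Num.max ((1 - 2 * gamma / alpha)^-1 * (2 * gamma / alpha)^-1)
    (sup [set ln n%:R ^+ 2 / n%:R `^ (1 - 2 * gamma / alpha)
         | n in [set n : nat | (1 <= n)%N]]).

End vocabulary.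

(* Main.v *)
Require Import Defs.
From HB Require Import structures.
From mathcomp Require Import all_boot all_order all_algebra.
From mathcomp Require Import all_classical all_reals all_analysis.
From mathcomp Require Import measurable_realfun.
From mathcomp Require Import ring lra zify.

Import Order.TTheory GRing.Theory Num.Theory.
Import numFieldNormedType.Exports.

Local Open Scope classical_set_scope.
Local Open Scope ring_scope.

Set Implicit Arguments.
Unset Strict Implicit.
Unset Printing Implicit Defensive.

(** The error of the integral sums is a sum over the cells of the grid of mesh
    [delta = T / n]. Write [Y t = h (X t)], [beta = 2 gamma / alpha], and for a
    fixed offset [tau] in [[0, delta]] let [a_k] be the increment of [Y] from the
    grid point [k delta] to [k delta + tau]. By Jensen's inequality the squared
    error is at most [delta] times the integral over [tau] of the square of the
    sum of the [a_k], so everything rests on the second moment of that sum for a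
    fixed [tau] ([second_moment_sum_le], [mean_square_error_le]). The Hölder
    condition and the bound on the transition density give
    [E (Y v - Y u)^2 <= const (v - u)^beta] ([increment_moment_le]), which
    controls the diagonal terms [a_k^2] and the products of adjacent increments.

    For cells that are farther apart, twice the expectation of [a_k a_l] is a
    combination of four second moments of increments of [Y]. By the Markov
    property, [E (Y v - Y u)^2] is the integral of [p u x y * Phi (v - u) y] in
    [y], where [Phi r y] is the second moment of [h (X r) - h y] under [P y]. The
    combination then splits into a second difference of [Phi] in time, and a
    product of a first difference of [p] and a first difference of [Phi]
    ([increment_moment_cross]). Working with the squares [(h z - h y)^2], which
    are bounded by a multiple of [|z - y|^(2 gamma)], is what makes the moment of
    order [2 gamma] of [Q] sufficient. With [m] cells between [k] and [l], the
    product has expectation of order [delta^beta (m^(beta-2) + m^(beta-1) / k)],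
    and summing over [k] and [l] gives [n delta^beta] for [beta < 1] and
    [n delta^beta ln n] for [beta = 1] ([variance_factor_lt1],
    [variance_factor_eq1]).

    The differences in time are bounded after integration in space, by the time
    integral of the bounds on the derivatives of [p]
    ([kernel_increment_le], [kernel_second_difference_le]). As the second
    derivative in time is only known to exist pointwise, this needs
    [|f b - f a| <= int |f'|] for a differentiable function with an arbitrary
    derivative ([le_increment_integral]), which is proved by a
    Vitali-Carathéodory argument. *)

(** * Increments of a differentiable function *)

Section increments.
Context {R : realType}.
Implicit Types (a b e r : R) (k : R -> \bar R).
Local Notation mu := (@lebesgue_measure R).

(** Discretization of the layer-cake formula, with the levels [0, e, 2 e, ...]. *)
Lemma sum_levels_le (e r : R) (n : nat) : 0 <= e -> 0 <= r ->
  \sum_(0 <= j < n) e * (j%:R * e <= r)%R%:R <= r + e.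
Proof.
move=> e0 r0.
have le_n m : \sum_(0 <= j < m) e * (j%:R * e <= r)%R%:R <= m%:R * e.
  elim: m => [|m IH]; first by rewrite big_geq// mul0r.
  rewrite big_nat_recr//= -natr1 mulrDl mul1r lerD//.
  by case: (_ <= r)%R; rewrite ?mulr1 ?mulr0.
elim: n => [|n IH]; first by rewrite big_geq ?addr_ge0.
rewrite big_nat_recr//=; case: (boolP (n%:R * e <= r)%R) => h.
  by rewrite mulr1 lerD2r (le_trans (le_n n)).
by rewrite mulr0 addr0.
Qed.

(** The superlevel sets [{k >= j s}] are enlarged to open sets [V j] whose excess
    measures have a small sum, and [g] is [s] times the sum of their indicators.
    If [k x >= r] then [x] lies in all the [V j] with [j s <= r], which are
    neighborhoods of [x], so [g] exceeds [r] around [x]. *)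
Lemma vitali_caratheodory a b k e : a <= b -> 0 < e ->
  measurable_fun `[a, b] k -> (forall x, x \in `[a, b] -> 0 <= k x)%E ->
  exists g : R -> \bar R, [/\ measurable_fun setT g, (forall x, 0 <= g x)%E,
    (forall x r, x \in `[a, b] -> 0 <= r -> (r%:E <= k x)%E ->
      exists2 c, r < c & \forall y \near x, (c%:E <= g y)%E) &
    (\int[mu]_(x in `[a, b]) g x <= \int[mu]_(x in `[a, b]) k x + e%:E)%E].
Proof.
move=> ab e0 mk k0.
pose s := e / (b - a + 1).
have ba1 : 0 < b - a + 1 by lra.
have s0 : 0 < s by rewrite /s divr_gt0.
pose F j := `[a, b]%classic `&` k @^-1` [set y | ((j%:R * s)%:E <= y)%E].
have mF j : measurable (F j).
  apply: mk => //.
  rewrite (_ : mkset _ = `[(j%:R * s)%:E, +oo[%classic).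
    exact: emeasurable_itv.
  by apply/seteqP; split => y /=; rewrite in_itv /= andbT.
have Foo j : (mu (F j) < +oo)%E.
  apply: (@le_lt_trans _ _ (mu `[a, b]%classic)).
    apply: le_measure; rewrite ?inE; [exact: mF|exact: measurable_itv|].
    exact: subIsetl.
  by rewrite lebesgue_measure_itv/=; case: ifP => _; rewrite ?ltry.
have /choice [V VP] : forall j, exists U : set R,
    [/\ open U, F j `<=` U & (mu (U `\` F j) < (1 / 2 ^+ j.+1)%:E)%E].
  move=> j; apply: lebesgue_regularity_outer => //.
  exact: Foo.
have mO j : measurable (V j) by apply: open_measurable; have [] := VP j.
pose g x := (\sum_(0 <= j <oo) (s * \1_(V j) x)%:E)%E.
have g0 (A : set R) x : (0 <= (s * \1_A x)%:E)%E.
  by rewrite lee_fin; apply: mulr_ge0; [exact: ltW|rewrite indicE; case: (_ \in _)].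
have mI (A : set R) : measurable A ->
    measurable_fun `[a, b]%classic (fun x => (s * \1_A x)%:E).
  move=> mA; apply/measurable_EFinP/measurable_funM.
    exact: measurable_cst.
  exact: measurable_indic.
have intI (A : set R) : measurable A ->
    (\int[mu]_(x in `[a, b]) (s * \1_A x)%:E = s%:E * mu (A `&` `[a, b]))%E.
  move=> mA; under eq_integral do rewrite EFinM.
  rewrite ge0_integralZl_EFin ?ltW//; first by rewrite integral_indic.
  by apply/measurable_EFinP; exact: measurable_indic.
have mg j : measurable_fun setT (fun x => (s * \1_(V j) x)%:E).
  apply/measurable_EFinP/measurable_funM; first exact: measurable_cst.
  exact: measurable_indic.
exists g; split.
- by apply: ge0_emeasurable_sum => [j x _ _|j _]; [exact: g0|exact: mg].
- by move=> x; apply: nneseries_ge0.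
- move=> x r xab r0 rk; pose N := Num.truncn (r / s).
  have Nr : N%:R * s <= r by rewrite -ler_pdivlMr// truncn_le// divr_ge0// ltW.
  have rN : r < N.+1%:R * s by rewrite -ltr_pdivrMr// truncnS_gt.
  exists (N.+1%:R * s) => //.
  have nV m : (m <= N.+1)%N -> \forall y \near x, forall j, (j < m)%N -> V j y.
    elim: m => [|m IH] mN.
      by near=> y; move=> j; rewrite ltn0.
    have nO : \forall y \near x, V m y.
      have [oO FO _] := VP m; apply: (open_nbhs_nbhs (conj oO _)); apply: FO.
      split; first by [].
      apply: le_trans rk; rewrite lee_fin (le_trans _ Nr)// ler_pM2r//.
      by rewrite ler_nat; exact: mN.
    have := IH (ltnW mN) => IHm; near=> y; move=> j; rewrite ltnS leq_eqVlt.
    case/orP => [/eqP ->|]; first by near: y; exact: nO.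
    by move: j; near: y; exact: IHm.
  apply: filterS (nV _ (leqnn _)) => y Vy; apply: le_trans (nneseries_lim_ge N.+1 _) => [|//].
  rewrite sumEFin lee_fin big_mkord (eq_bigr (fun=> s)).
    by rewrite sumr_const card_ord mulr_natl.
  move=> i _; rewrite indicE mem_set ?mulr1//; exact: (Vy i (ltn_ord i)).
- rewrite integral_nneseries; last 3 first.
  - exact: measurable_itv.
  - by move=> j; apply: measurable_funTS; exact: mg.
  - by move=> j x _; exact: g0.
  have sc j : 0 <= (1 / 2 ^+ j.+1 : R) by rewrite divr_ge0 ?exprn_ge0//.
  have intO j : (\int[mu]_(x in `[a, b]) (s * \1_(V j) x)%:E <=
      \int[mu]_(x in `[a, b]) (s * \1_(F j) x)%:E + (s / (2 ^ j.+1)%:R)%:E)%E.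
    rewrite !intI//.
    have -> : (s / (2 ^ j.+1)%:R)%:E = (s%:E * (1 / 2 ^+ j.+1)%:E)%E.
      by rewrite -EFinM mul1r natrX.
    rewrite -ge0_muleDr ?lee_fin//; apply: lee_wpmul2l; first by rewrite lee_fin ltW.
    have [oO FO /ltW OF] := VP j.
    apply: (@le_trans _ _ (mu (F j) + mu (V j `\` F j))%E).
      have mFj := mF j; have mVj := mO j.
      have mVF : measurable (V j `\` F j) by exact: measurableD.
      rewrite -measureU ?setDIK//.
      apply: le_measure; rewrite ?inE.
      - exact: measurableI mVj _.
      - exact: measurableU mFj mVF.
      - by move=> x [Ox _]; case: (pselect (F j x)) => ?; [left|right].
    rewrite leeD// (_ : F j `&` _ = F j)//.
    by apply/setIidPl; apply: subIsetl.
  apply: le_trans (lee_nneseries _ (fun j _ => intO j)) _.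
    by move=> j _ _; apply: integral_ge0.
  apply: le_trans (epsilon_trick _ _ (ltW s0)) _.
    move=> j; apply: integral_ge0 => x _.
    exact: g0.
  rewrite -integral_nneseries; last 3 first.
  - exact: measurable_itv.
  - by move=> j; apply: mI; exact: mF.
  - by move=> j x _; exact: g0.
  have -> : e%:E = ((s * (b - a))%:E + s%:E)%E.
    by rewrite -EFinD; congr EFin; rewrite /s; field; rewrite gt_eqF.
  rewrite addeA leeD2r//.
  have -> : (s * (b - a))%:E = (\int[mu]_(x in `[a, b]) s%:E)%E.
    rewrite integral_cst//= lebesgue_measure_itv/= lte_fin.
    case: ltP => //= ba; have -> : b = a by apply/le_anti/andP.
    by rewrite subrr mulr0 mule0.
  rewrite -ge0_integralD//; last by move=> x _; rewrite lee_fin ltW.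
  apply: ge0_le_integral => //.
  - by move=> x _; apply: nneseries_ge0 => j _ _;
      exact: g0.
  - apply: ge0_emeasurable_sum => [j x _ _|j _].
      exact: g0.
    exact: mI.
  - by apply: emeasurable_funD.
  - move=> x xab; apply: lime_le.
      by apply: is_cvg_nneseries => j _ _; exact: g0.
    near=> n; rewrite sumEFin.
    have xF j : \1_(F j) x = ((j%:R * s)%:E <= k x)%E%:R :> R.
      rewrite indicE; congr (_%:R); congr nat_of_bool.
      apply/idP/idP => [/set_mem[]//|h]; exact/mem_set.
    move: (k0 x xab) xF; case: (k x) => [r||]//.
      rewrite lee_fin => r0 xF; rewrite -EFinD lee_fin.
      apply: le_trans (sum_levels_le n (ltW s0) r0).
      by apply: ler_sum => j _; rewrite xF lee_fin.
    by move=> _ _; rewrite addye// leey.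
Unshelve. all: by end_near. Qed.

(** Continuous induction on the set [S] of the points where the increment of [f]
    from [a] is at most the integral of [g]: near a point [x], [g] is at least a
    constant larger than the slope of [f] at [x], so [S] contains its supremum
    and cannot stop before [b]. *)
Lemma increment_le_lsc a b (f : R -> R) (g : R -> \bar R) : a <= b ->
  measurable_fun setT g -> (forall x, 0 <= g x)%E ->
  (forall x, x \in `[a, b] -> derivable f x 1) ->
  (forall x, x \in `[a, b] -> exists2 c, `|f^`()%classic x| < c &
     \forall y \near x, (c%:E <= g y)%E) ->
  ((f b - f a)%:E <= \int[mu]_(x in `[a, b]) g x)%E.
Proof.
move=> ab mg g0 df fg.
pose G x := (\int[mu]_(t in `[a, x]) g t)%E.
have Gstep (x y c : R) : 0 <= c -> a <= x -> x <= y ->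
    (forall t, x <= t <= y -> (c%:E <= g t)%E) ->
    (G x + (c * (y - x))%:E <= G y)%E.
  move=> c0 ax xy cg.
  rewrite /G (@itv_bndbnd_setU _ _ (BLeft a) (BRight x) (BRight y)) ?bnd_simp//.
  rewrite ge0_integral_setU//=; last 2 first.
  - exact: measurable_funTS.
  - rewrite disj_set2E; apply/eqP; rewrite -subset0 => t [] /=.
    rewrite !in_itv/= => /andP[_ tx] /andP[xt _]; move: (lt_le_trans xt tx).
    by rewrite ltxx.
  rewrite leeD2l//; apply: (@le_trans _ _ (\int[mu]_(t in `]x, y]) c%:E)%E).
    rewrite integral_cst//= lebesgue_measure_itv/= lte_fin.
    case: ltP => [_|yx]; first by rewrite -EFinB -EFinM.
    have -> : y = x by apply/le_anti/andP.
    by rewrite subrr mulr0 mule0.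
  apply: ge0_le_integral => //=; first exact: measurable_funTS.
  by move=> t; rewrite in_itv /= => /andP[xt ty]; apply: cg; rewrite (ltW xt).
have near_step x : x \in `[a, b] -> exists2 e, 0 < e & forall u v,
    a <= u -> u <= v -> (u = x \/ v = x) -> v - u < e ->
    (G u + (f v - f u)%:E <= G v)%E.
  move=> xab; have [c fc gc] := fg x xab.
  have c0 : 0 <= c by rewrite (le_trans _ (ltW fc)).
  have dfx := df x xab.
  have /cvgr_norm_lt/(_ _ fc) : (fun h : R => h^-1 *: ((f \o shift x) (h *: 1) - f x)) @ 0^'
      --> f^`()%classic x by rewrite derive1E; exact: dfx.
  case=> /= e1 e10 He1; case: gc => /= e2 e20 He2.
  have fle y : `|y - x| < e1 -> `|f y - f x| <= c * `|y - x|.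
    move=> yx; have [->|nyx] := eqVneq y x; first by rewrite !subrr normr0 mulr0.
    have := He1 (y - x); rewrite /= sub0r normrN => /(_ yx).
    rewrite subr_eq0 => /(_ nyx); rewrite /shift/= [_ *: 1]mulr1 subrK.
    rewrite normrM normfV mulrC ltr_pdivrMr ?normr_gt0 ?subr_eq0// => /ltW.
    by rewrite mulrC.
  exists (Num.min e1 e2); first by rewrite lt_min e10.
  move=> u v au uv uvx; rewrite lt_min => /andP[uv1 uv2].
  apply: (@le_trans _ _ (G u + (c * (v - u))%:E)%E).
    rewrite leeD2l// lee_fin; apply: le_trans (ler_norm _) _.
    rewrite -[X in _ <= c * X](ger0_norm (_ : 0 <= v - u)) ?subr_ge0//.
    case: uvx => ux; rewrite ux in uv uv1 uv2 *.
      by apply: fle; rewrite ger0_norm ?subr_ge0.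
    rewrite distrC (distrC x u); apply: fle.
    by rewrite distrC ger0_norm ?subr_ge0.
  apply: Gstep => // t /andP[ut tv]; apply: He2 => /=.
  by case: uvx => ux; rewrite ?ux in ut tv uv2 *; rewrite ltr_norml; apply/andP; split; lra.
pose S : set R := [set x | x \in `[a, b] /\ ((f x - f a)%:E <= G x)%E].
have Sa : S a.
  split; first by rewrite in_itv/= lexx.
  by rewrite subrr; exact: integral_ge0.
have Sub : ubound S b by move=> x [/itvP->].
have Ssup : has_sup S by split; [exists a|exists b].
pose c := sup S.
have cab : c \in `[a, b].
  rewrite in_itv/=; apply/andP; split; first exact: (ub_le_sup (ex_intro _ b Sub)).
  by apply: ge_sup => //; exists a.
have [e e0 He] := near_step c cab.
have trans u v : S u -> ((G u + (f v - f u)%:E <= G v)%E) ->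
    ((f v - f a)%:E <= G v)%E.
  move=> [_ Su] uv; apply: le_trans uv.
  have -> : f v - f a = (f u - f a) + (f v - f u) by ring.
  by rewrite EFinD leeD2r.
have Sc : ((f c - f a)%:E <= G c)%E.
  have [x Sx cx] := sup_adherent e0 Ssup.
  have xc : x <= c by exact: (ub_le_sup (ex_intro _ b Sub)).
  apply: (trans x c Sx); apply: He => //; first by case: Sx => /itvP->.
  - by right.
  - by rewrite -/c in cx; lra.
have [cb|bc] := ltP c b; last first.
  by have <- : c = b by apply/le_anti; rewrite bc (itvP cab).
have ac : a <= c by rewrite (itvP cab).
pose y := Num.min b (c + e / 2).
have cy : c < y by rewrite lt_min cb/=; lra.
have yb : y <= b by rewrite ge_min lexx.
have ye : y <= c + e / 2 by rewrite ge_min lexx orbT.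
suff : S y by move/(ub_le_sup (ex_intro _ b Sub)); rewrite leNgt -/c cy.
split; first by rewrite in_itv/= yb andbT; lra.
apply: (trans c y) => //; apply: He => //; [lra|by left|lra].
Qed.

(** The derivative may be discontinuous, which puts the integral of [f^`()] out
    of reach of the fundamental theorem of calculus. A majorant [k] of its norm
    is replaced by the slightly larger [g] of [vitali_caratheodory], whose
    primitive grows locally faster than [f]. *)
Lemma le_increment_integral a b (f : R -> R) k : a <= b ->
  measurable_fun `[a, b] k ->
  (forall x, x \in `[a, b] -> derivable f x 1) ->
  (forall x, x \in `[a, b] -> (`|f^`()%classic x|%:E <= k x)%E) ->
  (`|f b - f a|%:E <= \int[mu]_(x in `[a, b]) k x)%E.
Proof.
move=> ab mk df fk; apply/lee_addgt0Pr => e e0.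
have [|g [mg g0 gk gint]] := vitali_caratheodory ab e0 mk.
  by move=> x xab; apply: le_trans (fk x xab); rewrite lee_fin.
apply: le_trans gint.
have gf x : x \in `[a, b] -> exists2 c, `|f^`()%classic x| < c &
    \forall y \near x, (c%:E <= g y)%E.
  by move=> xab; apply: gk => //; exact: fk.
have [_|_] := ger0P (f b - f a); first exact: increment_le_lsc.
have := @increment_le_lsc a b (\- f) g ab mg g0.
rewrite /= opprK opprB [- f b + _]addrC; apply => x xab; first exact/derivableN/df.
have [c fc gc] := gf x xab; exists c => //.
by rewrite derive1E deriveN ?normrN -?derive1E//; exact: df.
Qed.

End increments.

(** * Changes of variables in Lebesgue integrals *)

Section change_of_variables.
Context {R : realType}.
Local Notation mu := (@lebesgue_measure R).

(** The image of [c] times Lebesgue measure under [t |-> c (x - t)] gives the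
    intervals their lengths. *)
Lemma integral_scale_reflect (c x : R) (f : R -> \bar R) : 0 < c ->
  measurable_fun setT f -> (forall t, 0 <= f t)%E ->
  (\int[mu]_t f t = c%:E * \int[mu]_t f (c * (x - t))%R)%E.
Proof.
move=> c0 mf f0; pose phi t : R := c * (x - t).
have mphi : measurable_fun setT (phi : measurableTypeR R -> measurableTypeR R).
  by apply: measurable_funM => //; exact: measurable_funB.
pose k := NngNum (ltW c0).
transitivity (\int[pushforward (mscale k mu)
    (phi : measurableTypeR R -> measurableTypeR R)]_t f t)%E.
  apply: eq_measure_integral => // A mA _.
  apply: lebesgue_measure_unique => // _ [[u v] _ <-].
  change (mu `]u, v] = (c%:E * mu (phi @^-1` `]u, v]))%E).
  have -> : phi @^-1` `]u, v] = `[x - v / c, x - u / c[%classic.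
    apply/seteqP; split => t /=; rewrite !in_itv /= /phi => /andP[ut tv].
      have : v / c >= x - t by rewrite ler_pdivlMr// mulrC.
      have : u / c < x - t by rewrite ltr_pdivrMr// mulrC.
      by move=> ? ?; apply/andP; split; lra.
    have : x - t <= v / c by lra.
    have : u / c < x - t by lra.
    by rewrite ler_pdivlMr// ltr_pdivrMr// mulrC => -> ->.
  rewrite !lebesgue_measure_itv/= !lte_fin.
  have -> : (x - v / c < x - u / c) = (u < v).
    by rewrite ltrD2l ltrN2 ltr_pM2r ?invr_gt0.
  case: ifP => _; last by rewrite mule0.
  rewrite -EFinD -EFinM; congr EFin; field; exact: lt0r_neq0.
rewrite ge0_integral_pushforward//= preimage_setT.
rewrite ge0_integral_mscale//.
exact: measurableT_comp.
Qed.

Lemma integral_translation (b : R) (f : R -> \bar R) :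
  measurable_fun setT f -> (forall t, 0 <= f t)%E ->
  (\int[mu]_t f t = \int[mu]_t f (t + b)%R)%E.
Proof.
move=> mf f0; rewrite (@integral_scale_reflect 1 b)// mul1e.
have mg : measurable_fun setT (fun t : R => f (t + b)).
  by apply: measurableT_comp => //; exact: measurable_funD.
rewrite [RHS](@integral_scale_reflect 1 0)// mul1e.
by apply: eq_integral => t _; congr f; ring.
Qed.

Lemma integral_rV_cons n (F : 'rV[R]_n.+1 -> \bar R) :
  measurable_fun setT F -> (forall z, 0 <= F z)%E ->
  (\int[lebesgue_rV n.+1]_z F z =
   \int[mu]_t \int[lebesgue_rV n]_z F (cons_rV (t, z)))%E.
Proof.
move=> mF F0.
transitivity (\int[pushforward (mu \x lebesgue_rV n) (@cons_rV R n)]_z F z)%E.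
  by [].
rewrite ge0_integral_pushforward//=; last exact: measurable_cons_rV.
rewrite preimage_setT fubini_tonelli1//.
by apply: measurableT_comp => //; exact: measurable_cons_rV.
Qed.

Lemma integral_rV_scale_reflect n (c : R) (x : 'rV[R]_n)
    (F : 'rV[R]_n -> \bar R) : 0 < c ->
  measurable_fun setT F -> (forall z, 0 <= F z)%E ->
  (\int[lebesgue_rV n]_z F z =
   (c ^+ n)%:E * \int[lebesgue_rV n]_z F (c *: (x - z))%R)%E.
Proof.
move=> c0; elim: n x F => [|n IH] x F mF F0.
  rewrite expr0 mul1e; apply: eq_integral => z _; congr F.
  by apply/rowP => -[].
have mphi (y : 'rV[R]_n.+1) : measurable_fun setT (fun z : 'rV[R]_n.+1 => c *: (y - z)).
  apply/measurable_fun_rVP => i.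
  apply: (eq_measurable_fun (fun z : 'rV[R]_n.+1 => c * (y ord0 i - z ord0 i))) => [z _|].
    by rewrite !mxE.
  apply: measurable_funM => //; apply: measurable_funB => //.
  exact: measurable_coord_rV.
have mFc (t : R) : measurable_fun setT (fun z : 'rV[R]_n => F (cons_rV (t, z))).
  have mp : measurable_fun setT (fun z : 'rV[R]_n => (t, z)).
    exact: measurable_fun_pair.
  exact: (measurableT_comp mF (measurableT_comp (@measurable_cons_rV R n) mp)).
have mFphi := measurableT_comp mF (mphi x).
rewrite !integral_rV_cons//.
pose x' := (uncons_rV x).2; pose x0 := x ord0 ord0.
have consE t z : c *: (x - cons_rV (t, z)) = cons_rV (c * (x0 - t), c *: (x' - z)).
  apply/rowP => i; rewrite /cons_rV !mxE; case: unliftP => [j ->|->] /=; rewrite ?mxE //.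
have mG : measurable_fun setT (fun t => \int[lebesgue_rV n]_z F (cons_rV (t, z)))%E.
  apply: (@measurable_fun_fubini_tonelli_F _ _ _ _ _ (lebesgue_rV n)
    (fun u : R * 'rV[R]_n => F (cons_rV u))) => //.
  by apply: measurableT_comp => //; exact: measurable_cons_rV.
have -> := integral_scale_reflect x0 c0 mG
  (fun t => integral_ge0 _ (fun z _ => F0 (cons_rV (t, z)))).
rewrite exprS EFinM -muleA; congr (_ * _)%E.
rewrite -ge0_integralZl_EFin//; last 3 first.
- by move=> t _; apply: integral_ge0.
- apply: (@measurable_fun_fubini_tonelli_F _ _ _ _ _ (lebesgue_rV n)
    (fun u : R * 'rV[R]_n => F (c *: (x - cons_rV u)))) => //.
  apply: (measurableT_comp mFphi); exact: measurable_cons_rV.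
- by rewrite exprn_ge0 ?ltW.
apply: eq_integral => t _; rewrite (IH x')//.
by congr (_ * _)%E; apply: eq_integral => z _; rewrite consE.
Qed.

End change_of_variables.

(** * The Euclidean norm and the rescaled density *)

Section rescaled_density.
Context {R : realType} {d : nat}.
Implicit Types (x y z : 'rV[R]_d) (v alpha : R) (Q : 'rV[R]_d -> R).

Lemma enorm_ge0 z : 0 <= enorm z. Proof. exact: sqrtr_ge0. Qed.

Lemma enormZ (c : R) z : enorm (c *: z) = `|c| * enorm z.
Proof.
rewrite /enorm; under eq_bigr do rewrite mxE exprMn.
by rewrite -mulr_sumr sqrtrM ?sqr_ge0// sqrtr_sqr.
Qed.

Lemma enorm_gt0 z : z != 0 -> 0 < enorm z.
Proof.
move=> z0; rewrite sqrtr_gt0 lt0r sumr_ge0 ?andbT; last by move=> i _; exact: sqr_ge0.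
apply: contra z0 => /eqP s0; apply/eqP/rowP => i; rewrite mxE; apply/eqP.
by rewrite -sqrf_eq0; apply/eqP; apply: (psumr_eq0P _ s0) => // j _; exact: sqr_ge0.
Qed.

Lemma enorm_le_coord z e : 0 < e -> (forall i, `|z ord0 i| <= e) ->
  enorm z <= Num.sqrt d%:R * e.
Proof.
move=> e0 ze; rewrite -(ger0_norm (ltW e0)) -sqrtr_sqr -sqrtrM// ler_sqrt.
  rewrite mulr_natl -[d in _ *+ d]card_ord -sumr_const.
  apply: ler_sum => i _; rewrite -[leLHS]real_normK ?num_real//.
  by apply: lerXn2r; rewrite ?nnegrE// ltW.
by rewrite mulr_ge0// sqr_ge0.
Qed.

Lemma measurable_enorm : measurable_fun setT (fun z => enorm z).
Proof.
apply: (measurableT_comp (continuous_measurable_fun (@sqrt_continuous R))).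
apply: measurable_sum => i; apply: measurable_funX; exact: measurable_coord_rV.
Qed.

Lemma measurable_rV_sub : 
  measurable_fun setT (fun u : 'rV[R]_d * 'rV[R]_d => u.1 - u.2).
Proof.
apply/measurable_fun_rVP => i.
apply: (eq_measurable_fun (fun u : 'rV[R]_d * 'rV[R]_d => u.1 ord0 i - u.2 ord0 i)) => [z _|].
  by rewrite !mxE.
by apply: measurable_funB;
  [apply: (measurableT_comp (measurable_coord_rV i) measurable_fst)
  |apply: (measurableT_comp (measurable_coord_rV i) measurable_snd)].
Qed.

Lemma measurable_rV_scale dT (U : measurableType dT) (c : U -> R) (f : U -> 'rV[R]_d) :
  measurable_fun setT c -> measurable_fun setT f ->
  measurable_fun setT (fun u => c u *: f u).
Proof.
move=> mc mf; apply/measurable_fun_rVP => i.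
apply: (eq_measurable_fun (fun u => c u * f u ord0 i)) => [z _|].
  by rewrite !mxE.
apply: measurable_funM => //; exact: (measurableT_comp (measurable_coord_rV i)).
Qed.

(** The density of [v^(1/alpha) Z] when [Z] has density [Q]. *)
Definition rescaled alpha Q v z := v `^ (- (d%:R / alpha)) * Q (v `^ (- alpha^-1) *: z).

Lemma rescaled_ge0 alpha Q v z : (forall z, 0 <= Q z) -> 0 <= rescaled alpha Q v z.
Proof. by move=> Q0; rewrite mulr_ge0 ?powR_ge0. Qed.

Lemma measurable_rescaled alpha Q y : measurable_fun setT Q ->
  measurable_fun setT (fun u : R * 'rV[R]_d => rescaled alpha Q u.1 (y - u.2)).
Proof.
move=> mQ; apply: measurable_funM.
  by apply: (measurableT_comp (measurable_powR _)); exact: measurable_fst.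
apply: (measurableT_comp mQ); apply: measurable_rV_scale.
  by apply: (measurableT_comp (measurable_powR _)); exact: measurable_fst.
have mp : measurable_fun setT (fun u : R * 'rV[R]_d => (y, u.2)).
  by apply: measurable_fun_pair => //; exact: measurable_snd.
exact: (measurableT_comp measurable_rV_sub mp).
Qed.

Lemma integral_rescaled_moment alpha Q v y (r : R) : 0 < v -> 0 < alpha -> 
  measurable_fun setT Q -> (forall z, 0 <= Q z) ->
  (\int[lebesgue_rV d]_z (enorm (y - z) `^ r * rescaled alpha Q v (y - z))%:E =
   (v `^ (r / alpha))%:E * moment Q r)%E.
Proof.
move=> v0 a0 mQ Q0; set c := v `^ (- alpha^-1).
have c0 : 0 < c by rewrite powR_gt0.
pose F z := (enorm z `^ r * Q z)%:E.
have mF : measurable_fun setT F.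
  apply/measurable_EFinP/measurable_funM => //.
  by apply: (measurableT_comp (measurable_powR _)); exact: measurable_enorm.
have F0 z : (0 <= F z)%E by rewrite lee_fin mulr_ge0 ?powR_ge0.
rewrite /moment (integral_rV_scale_reflect y c0 mF F0) muleA -EFinM.
rewrite -ge0_integralZl_EFin//; last 2 first.
- have mp : measurable_fun setT (fun z : 'rV[R]_d => (y, z)).
    by apply: measurable_fun_pair.
  apply: (measurableT_comp mF); apply: measurable_rV_scale => //.
  exact: (measurableT_comp measurable_rV_sub mp).
- by rewrite mulr_ge0 ?powR_ge0// exprn_ge0// ltW.
apply: eq_integral => z _; rewrite /F -EFinM; congr EFin.
rewrite enormZ (ger0_norm (ltW c0)) powRM ?enorm_ge0 ?ltW// /rescaled -/c.
have -> : v `^ (- (d%:R / alpha)) = c ^+ d.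
  by rewrite -powR_mulrn ?powR_ge0// -powRrM; congr (_ `^ _); ring.
have -> : c `^ r = (v `^ (r / alpha))^-1.
  by rewrite -powRrM -powRN; congr (_ `^ _); ring.
field; rewrite lt0r_neq0// powR_gt0//.
Qed.

Lemma integral_rescaled alpha Q v y : 0 < v -> 0 < alpha -> is_density Q ->
  (\int[lebesgue_rV d]_z (rescaled alpha Q v (y - z))%:E = 1)%E.
Proof.
move=> v0 a0 [mQ Q0 Q1].
have := integral_rescaled_moment y 0 v0 a0 mQ Q0.
have m0 : moment Q 0 = 1%E.
  by rewrite -Q1; apply: eq_integral => z _; rewrite powRr0 mul1r.
rewrite m0 mul0r powRr0 mul1e => <-.
by apply: eq_integral => z _; rewrite powRr0 mul1r.
Qed.

End rescaled_density.

(** * Hölder functions *)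

Section holder.
Context {R : realType} {d : nat}.
Variables (gamma : R) (h : 'rV[R]_d -> R).
Hypotheses (gamma0 : 0 < gamma) (hoo : (holder_seminorm gamma h < +oo)%E).
Local Notation H := (fine (holder_seminorm gamma h)).

Lemma holder_seminorm_le x y : `|h x - h y| <= H * enorm (x - y) `^ gamma.
Proof.
have [->|xy] := eqVneq x y.
  rewrite !subrr normr0 -[0 : 'rV_d](scale0r (0 : 'rV[R]_d)) enormZ normr0 mul0r.
  by rewrite powR0 ?mulr0// gt_eqF.
have e0 : 0 < enorm (x - y) by rewrite enorm_gt0// subr_eq0.
rewrite -ler_pdivrMr ?powR_gt0// -lee_fin.
have le_sup : ((`|h x - h y| / enorm (x - y) `^ gamma)%:E <= holder_seminorm gamma h)%E.
  by apply: ereal_sup_ubound; exists (x, y).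
rewrite fineK// fin_numE; apply/andP; split; last by rewrite lt_eqF.
by rewrite gt_eqF// (lt_le_trans _ le_sup)// ltNyr.
Qed.

Lemma holder_seminorm_ge0 : (0 < d)%N -> 0 <= H.
Proof.
move=> d0; rewrite fine_ge0//.
pose x : 'rV[R]_d := \row__ 1.
have x0 : x != 0.
  apply/eqP => /rowP/(_ (Ordinal d0)) /eqP; rewrite !mxE oner_eq0//.
apply: (@le_trans _ _ (`|h x - h 0| / enorm (x - 0) `^ gamma)%:E).
  by rewrite lee_fin divr_ge0 ?powR_ge0.
by apply: ereal_sup_ubound; exists (x, 0).
Qed.

(** By the Hölder bound and the density of the rational points [q], [h x] is
    the infimum over [q] of [h q + H |x - q|^gamma], so the open sublevel sets
    of [h] are countable unions of measurable sets. *)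
Lemma measurable_holder : (0 < d)%N -> measurable_fun setT h.
Proof.
move=> d0; have H0 := holder_seminorm_ge0 d0.
apply: (measurability _ (RGenInftyO.measurableE R)).
move=> _ [_ [r ->] <-]; rewrite setTI.
pose rv (q : 'rV[rat]_d) : 'rV[R]_d := \row_i ratr (q ord0 i).
pose g q x := h (rv q) + H * enorm (x - rv q) `^ gamma.
have -> : h @^-1` `]-oo, r[ = \bigcup_q (g q @^-1` `]-oo, r[%classic).
  apply/seteqP; split => [x|x [q _]] /=; rewrite !in_itv/=; last first.
    apply: le_lt_trans; rewrite /g -lerBlDl.
    exact: le_trans (ler_norm _) (holder_seminorm_le _ _).
  move=> hxr; pose e := (r - h x) / (2 * H + 1).
  have den0 : 0 < 2 * H + 1 by lra.
  have e0 : 0 < e by rewrite divr_gt0// subr_gt0.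
  pose s := e `^ gamma^-1.
  have s0 : 0 < s by rewrite powR_gt0.
  pose t := s / Num.sqrt d%:R.
  have sd : 0 < Num.sqrt d%:R :> R by rewrite sqrtr_gt0 ltr0n.
  have t0 : 0 < t by rewrite divr_gt0.
  have /choice [q qP] : forall i, exists q : rat,
      ratr q \in `]x ord0 i - t, x ord0 i + t[.
    by move=> i; apply: rat_in_itvoo; lra.
  pose Q := \row_i q i; exists Q => //=; rewrite in_itv /g/=.
  have eQ : enorm (x - rv Q) <= s.
    have -> : s = Num.sqrt d%:R * t by rewrite /t mulrC divfK ?gt_eqF.
    apply: enorm_le_coord => // i; rewrite !mxE.
    have := qP i; rewrite in_itv/= => /andP[q1 q2].
    by rewrite ler_norml; apply/andP; split; lra.
  have eg : enorm (x - rv Q) `^ gamma <= e.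
    have -> : e = s `^ gamma by rewrite /s -powRrM mulVf ?gt_eqF// powRr1// ltW.
    by apply: ge0_ler_powR; rewrite ?nnegrE ?enorm_ge0// ltW.
  have := holder_seminorm_le x (rv Q); rewrite distrC => /(le_trans (ler_norm _)).
  have := ler_wpM2l H0 eg.
  have : e * (2 * H + 1) = r - h x by rewrite /e divfK ?gt_eqF.
  by nra.
apply: countable_bigcupT_measurable => [|q]; first exact: countableP.
rewrite -[X in measurable X]setTI.
have mg : measurable_fun setT (g q).
  apply: measurable_funD => //; apply: measurable_funM => //.
  apply: (measurableT_comp (measurable_powR _)).
  apply: (measurableT_comp measurable_enorm).
  have mp : measurable_fun setT (fun x : 'rV[R]_d => (x, rv q)).
    exact: measurable_fun_pair.
  exact: (measurableT_comp measurable_rV_sub mp).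
exact: mg.
Qed.

End holder.

(** * Densities *)

Section density_measure.
Context {dT : measure_display} {U : measurableType dT} {R : realType}.
Variables (mu : {measure set U -> \bar R}) (f : U -> R).
Hypotheses (mf : measurable_fun setT f) (f0 : forall x, 0 <= f x).

(** The proofs are arguments so that the measure structure can be inferred. *)
Definition density_measure of measurable_fun setT f & (forall x, 0 <= f x) :=
  fun A => (\int[mu]_(x in A) (f x)%:E)%E.
Local Notation nu := (density_measure mf f0).

Let nu0 : nu set0 = 0%E. Proof. exact: integral_set0. Qed.

Let nu_ge0 A : (0 <= nu A)%E.
Proof. by apply: integral_ge0 => x _; rewrite lee_fin. Qed.

Let nu_sigma_additive : semi_sigma_additive nu.
Proof.
move=> F mF tF mUF; rewrite /density_measure.
rewrite ge0_integral_bigcup//; last 2 first.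
- by apply/measurable_EFinP; exact: measurable_funTS.
- by move=> x _; rewrite lee_fin.
by apply: is_cvg_nneseries => n _ _; exact: nu_ge0.
Qed.

HB.instance Definition _ := isMeasure.Build _ _ _ nu nu0 nu_ge0 nu_sigma_additive.

End density_measure.

Section integral_of_density.
Context {dT : measure_display} {U : measurableType dT} {R : realType}.
Variables (mu nu : {measure set U -> \bar R}) (f : U -> R).
Hypotheses (mf : measurable_fun setT f) (f0 : forall x, 0 <= f x).
Hypothesis nuE : forall A, measurable A -> nu A = (\int[mu]_(x in A) (f x)%:E)%E.
Local Open Scope ereal_scope.
Import HBNNSimple.

Let mfE : measurable_fun setT (EFin \o f). Proof. exact/measurable_EFinP. Qed.

Let integral_density_nnsfun (g : {nnsfun U >-> R}) :
  \int[nu]_x (g x)%:E = \int[mu]_x ((g x)%:E * (f x)%:E).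
Proof.
under eq_integral do rewrite fimfunE -fsumEFin//.
rewrite ge0_integral_fsum//; last 2 first.
- by move=> r; apply/measurable_EFinP/measurable_funM.
- by move=> r x _; exact: nnfun_muleindic_ge0.
transitivity (\int[mu]_x (\sum_(y \in range g)
    (y * \1_(g @^-1` [set y]) x)%:E * (f x)%:E)); last first.
  apply: eq_integral => x _.
  rewrite -ge0_mule_fsuml => [|y]; last exact: nnfun_muleindic_ge0.
  by rewrite fsumEFin// -fimfunE.
have mi r : measurable_fun setT (fun x => (\1_(g @^-1` [set r]) x)%:E * (f x)%:E).
  by apply: emeasurable_funM => //; apply/measurable_EFinP.
rewrite ge0_integral_fsum//; last 2 first.
- move=> r; apply: emeasurable_funM => //.
  by apply/measurable_EFinP/measurable_funM.
- by move=> r x _; rewrite mule_ge0 ?lee_fin// ?f0// -lee_fin nnfun_muleindic_ge0.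
apply: eq_fsbigr => r rg.
rewrite integralZl_indic_nnsfun// integral_indic// setIT nuE//.
under [RHS]eq_integral do rewrite EFinM -muleA.
have r0 : (0 <= r)%R by move: rg; rewrite inE => -[t _ <-].
rewrite ge0_integralZl_EFin//; last first.
  by move=> x _; rewrite mule_ge0// lee_fin.
congr (_ * _); rewrite integral_mkcond; apply: eq_integral => x _.
by rewrite epatch_indic muleC.
Qed.

Lemma integral_density (g : U -> \bar R) : measurable_fun setT g ->
  (forall x, 0 <= g x) -> \int[nu]_x g x = \int[mu]_x (g x * (f x)%:E).
Proof.
move=> mg g0; pose g_ := nnsfun_approx measurableT mg.
have g_cvg x : (g_ n x)%:E @[n --> \oo] --> g x by exact: cvg_nnsfun_approx.
transitivity (limn (fun n => \int[nu]_x (g_ n x)%:E)).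
  rewrite -monotone_convergence//.
  - by apply: eq_integral => x _; apply/esym/cvg_lim.
  - by move=> n; apply/measurable_EFinP.
  - by move=> n x _; rewrite lee_fin.
  - by move=> x _ m n mn; rewrite lee_fin; exact/lefP/nd_nnsfun_approx.
under eq_fun do rewrite integral_density_nnsfun.
rewrite -monotone_convergence//.
- by apply: eq_integral => x _; apply/cvg_lim => //; exact: cvgeZr.
- by move=> n; apply: emeasurable_funM => //; apply/measurable_EFinP.
- by move=> n x _; rewrite mule_ge0 ?lee_fin.
- move=> x _ m n mn; rewrite lee_wpmul2r ?lee_fin//.
  exact/lefP/nd_nnsfun_approx.
Qed.

End integral_of_density.

(** * One- and two-time distributions of the process *)

Section finite_dimensional.
Context {R : realType} {d : nat} {dO : measure_display} {Omega : measurableType dO}.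
Variables (X : R -> Omega -> 'rV[R]_d) (P : 'rV[R]_d -> probability Omega R).
Variable p : R -> 'rV[R]_d -> 'rV[R]_d -> R.
Hypotheses (mX : markov_process X P) (pX : transition_density X P p).
Implicit Types (x y z : 'rV[R]_d) (u v : R).
Local Notation leb := (lebesgue_rV d).
Local Open Scope ereal_scope.

Lemma measurable_density u x : (0 < u)%R -> measurable_fun setT (p u x).
Proof.
move=> u0; have [mp _ _] := pX u0.
have mq : measurable_fun setT (fun y : 'rV[R]_d => (x, y)) by exact: measurable_fun_pair.
exact: (measurableT_comp mp mq).
Qed.

Lemma density_ge0 u x y : (0 < u)%R -> (0 <= p u x y)%R.
Proof. by move=> u0; have [_ + _] := pX u0; exact. Qed.

Lemma expect_density (F : 'rV[R]_d -> \bar R) u x : (0 < u)%R ->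
  measurable_fun setT F -> (forall y, 0 <= F y) ->
  \int[P x]_w F (X u w) = \int[leb]_y ((p u x y)%:E * F y).
Proof.
move=> u0 mF F0.
have mXu : measurable_fun setT (X u) by apply: (markov_measurable mX); exact: ltW.
transitivity (\int[pushforward (P x) (X u)]_y F y).
  by rewrite ge0_integral_pushforward// preimage_setT.
under [RHS]eq_integral do rewrite muleC.
apply: integral_density => //.
- exact: measurable_density.
- by move=> y; exact: density_ge0.
- by move=> A mA; have [_ _ pE] := pX u0; exact: pE.
Qed.

Lemma measurable_transition_mass u B : (0 < u)%R -> measurable B ->
  measurable_fun setT (fun y => \int[leb]_(z in B) (p u y z)%:E).
Proof.
move=> u0 mB; have [_ _ pE] := pX u0.
apply: (eq_measurable_fun (fun y => P y (X u @^-1` B))) => [y _ /=|].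
  by rewrite pE.
by apply: (markov_kernel mX) => //; exact: ltW.
Qed.

(** The Markov property for the event [X u \in A], which belongs to the natural
    filtration at time [u]. *)
Lemma two_time_rectangle u v x A B : (0 < u < v)%R -> measurable A -> measurable B ->
  P x (X u @^-1` A `&` X v @^-1` B) =
  \int[leb]_(y in A) ((p u x y)%:E * \int[leb]_(z in B) (p (v - u) y z)%:E).
Proof.
move=> /andP[u0 uv] mA mB; have vu0 : (0 < v - u)%R by rewrite subr_gt0.
have [_ _ pE] := pX vu0.
have mXu : measurable_fun setT (X u) by apply: (markov_measurable mX); exact: ltW.
have mXA : measurable (X u @^-1` A) by rewrite -[X in measurable X]setTI; exact: mXu.
have filA : natural_filtration X u (X u @^-1` A).
  apply: sub_sigma_algebra; exists u; first by rewrite /= in_itv/= lexx ltW.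
  by exists A => //; rewrite setTI.
have := markov_property mX x (ltW u0) (ltW vu0) filA mB.
rewrite [(u + (v - u))%R]addrC subrK => ->.
under eq_integral do rewrite pE//.
pose K y := \int[leb]_(z in B) (p (v - u) y z)%:E.
have K0 y : 0 <= K y.
  by apply: integral_ge0 => z _; rewrite lee_fin density_ge0.
have mK : measurable_fun setT K by exact: measurable_transition_mass.
rewrite integral_mkcond [RHS]integral_mkcond.
transitivity (\int[P x]_w ((K \_ A) (X u w))).
  by apply: eq_integral => w _; rewrite !patchE.
rewrite expect_density//.
- by apply: eq_integral => y _; rewrite !patchE; case: ifP => _; rewrite ?mule0.
- by apply/(measurable_restrictT _ mA); exact: measurable_funTS.
- by move=> y; rewrite patchE; case: ifP.
Qed.

(** The law of [(X u, X v)] and the measure with density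
    [p u x y * p (v - u) y z] agree on rectangles, hence on all Borel sets. *)
Lemma expect_two_time (F : 'rV[R]_d * 'rV[R]_d -> \bar R) u v x : (0 < u < v)%R ->
  measurable_fun setT F -> (forall yz, 0 <= F yz) ->
  \int[P x]_w F (X u w, X v w) =
  \int[leb]_y ((p u x y)%:E * \int[leb]_z ((p (v - u) y z)%:E * F (y, z))).
Proof.
move=> uv mF F0; have /andP[u0 uv'] := uv.
have v0 := lt_trans u0 uv'; have vu0 : (0 < v - u)%R by rewrite subr_gt0.
have mXu : measurable_fun setT (X u) by apply: (markov_measurable mX); exact: ltW.
have mXv : measurable_fun setT (X v) by apply: (markov_measurable mX); exact: ltW.
pose phi w := (X u w, X v w).
have mphi : measurable_fun setT phi by exact: measurable_fun_pair.
pose q (yz : 'rV[R]_d * 'rV[R]_d) := (p u x yz.1 * p (v - u) yz.1 yz.2)%R.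
have mq : measurable_fun setT q.
  apply: measurable_funM.
    exact: (measurableT_comp (measurable_density x u0) measurable_fst).
  by have [] := pX vu0.
have q0 yz : (0 <= q yz)%R by rewrite mulr_ge0 ?density_ge0.
have mqE : measurable_fun setT (fun yz => (q yz)%:E) by exact/measurable_EFinP.
transitivity (\int[pushforward (P x) phi]_y F y).
  by rewrite ge0_integral_pushforward// preimage_setT.
transitivity (\int[leb \x leb]_y (F y * (q y)%:E)).
  apply: integral_density => // A mA.
  pose C : set (set ('rV[R]_d * 'rV[R]_d)) :=
    [set A `*` B | A in measurable & B in measurable].
  apply: (measure_unique C (fun=> setT) _ _ _ _
    (pushforward (P x) phi) (density_measure (leb \x leb) mq q0)) => //.
  - by rewrite measurable_prod_measurableType.
  - move=> _ _ [A1 mA1 [A2 mA2 <-]] [B1 mB1 [B2 mB2 <-]].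
    rewrite -setXI; exists (A1 `&` B1); first exact: measurableI.
    by exists (A2 `&` B2) => //; exact: measurableI.
  - by move=> _; exists setT => //; exists setT => //; rewrite setXTT.
  - by apply/seteqP; split => // z _; exists 0%N.
  - move=> _ [A1 mA1 [A2 mA2 <-]].
    change (P x (X u @^-1` A1 `&` X v @^-1` A2) =
      \int[leb \x leb]_(yz in A1 `*` A2) (q yz)%:E).
    rewrite two_time_rectangle// [RHS]integral_mkcond fubini_tonelli1//; last 2 first.
    - apply/(measurable_restrictT _ (measurableX mA1 mA2)).
      exact: measurable_funTS.
    - by move=> z; rewrite patchE; case: ifP => _; rewrite ?lee_fin.
    rewrite integral_mkcond; apply: eq_integral => y _.
    rewrite patchE /fubini_F; case: ifP => yA1; last first.
      rewrite integral0_eq// => z _; rewrite patchE ifF//.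
      by apply/negbTE/negP => /set_mem [/= yA _]; rewrite mem_set in yA1.
    rewrite -ge0_integralZl_EFin ?density_ge0//; last 2 first.
    - by move=> z _; rewrite lee_fin density_ge0.
    - by apply/measurable_EFinP/measurable_funTS; exact: measurable_density.
    rewrite [LHS]integral_mkcond; apply: eq_integral => z _.
    rewrite !patchE in_setX yA1/=; case: ifP => // _.
  - by move=> _; change (P x [set: Omega] < +oo); rewrite probability_setT ltry.
rewrite fubini_tonelli1; last 2 first.
- exact: emeasurable_funM.
- by move=> y; rewrite mule_ge0 ?lee_fin.
apply: eq_integral => y _; rewrite /fubini_F.
have mp : measurable_fun setT (fun z : 'rV[R]_d => (y, z)) by exact: measurable_fun_pair.
rewrite -ge0_integralZl_EFin ?density_ge0//; last 2 first.
- by move=> z _; rewrite mule_ge0 ?lee_fin ?density_ge0.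
- apply: emeasurable_funM; last exact: (measurableT_comp mF mp).
  by apply/measurable_EFinP; exact: measurable_density.
by apply: eq_integral => z _; rewrite /q/= EFinM muleC -muleA.
Qed.

Lemma expect_start (F : 'rV[R]_d * 'rV[R]_d -> \bar R) v x : (0 <= v)%R ->
  measurable_fun setT F -> (forall yz, 0 <= F yz) ->
  \int[P x]_w F (X 0 w, X v w) = \int[P x]_w F (x, X v w).
Proof.
move=> v0 mF F0.
have mX0 : measurable_fun setT (X 0) by exact: (markov_measurable mX).
have mXv : measurable_fun setT (X v) by exact: (markov_measurable mX).
have x1E : [set x] = [set y : 'rV[R]_d | forall i, (x ord0 i <= y ord0 i <= x ord0 i)%R].
  apply/seteqP; split => [y -> i|y /= xy]; first by rewrite lexx.
  by apply/rowP => i; apply/esym/le_anti/xy.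
have mx1 : measurable [set x] by rewrite x1E; exact: measurable_box_rV.
have mS : measurable (X 0 @^-1` [set x]).
  by rewrite -[X in measurable X]setTI; exact: mX0.
apply: ge0_ae_eq_integral => //.
- by apply: (measurableT_comp mF); exact: measurable_fun_pair.
- by apply: (measurableT_comp mF); exact: measurable_fun_pair.
exists (~` (X 0 @^-1` [set x])); split; first exact: measurableC.
  by have := probability_setC (P x) mS; rewrite (markov_start mX x) subee.
by move=> w /= /not_implyP[_ h] X0; apply: h; rewrite X0.
Qed.

End finite_dimensional.

(** * Time regularity of a kernel in integrated form *)

Section tonelli.
Context {R : realType} {dV : measure_display} {V : measurableType dV}.
Local Notation mu := (@lebesgue_measure R).
Variables (A : set R) (k : R * V -> \bar R).
Hypotheses (mA : measurable A) (mk : measurable_fun setT k).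
Hypothesis k0 : forall uz, (0 <= k uz)%E.
Local Open Scope ereal_scope.

Let g := k \_ (A `*` setT).

Let mg : measurable_fun setT g.
Proof.
have mAT : measurable (A `*` [set: V]) by exact: measurableX.
by apply/(measurable_restrictT _ mAT); exact: measurable_funTS.
Qed.

Let g0 uz : 0 <= g uz. Proof. by rewrite /g patchE; case: ifP. Qed.

Let gE u z : g (u, z) = ((fun u => k (u, z)) \_ A) u.
Proof. by rewrite /g !patchE in_setX in_setT andbT. Qed.

Let integral_g z : \int[mu]_u g (u, z) = \int[mu]_(u in A) k (u, z).
Proof.
by rewrite [RHS]integral_mkcond; apply: eq_integral => u _; rewrite gE.
Qed.

Lemma measurable_restricted_integral :
  measurable_fun setT (fun z => \int[mu]_(u in A) k (u, z)).
Proof.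
apply: (eq_measurable_fun (fun z => \int[mu]_u g (u, z))) => [z _ /=|].
  by rewrite integral_g.
exact: (@measurable_fun_fubini_tonelli_G _ _ _ _ _ mu g).
Qed.

Lemma restricted_tonelli (m : {sigma_finite_measure set V -> \bar R}) :
  \int[m]_z \int[mu]_(u in A) k (u, z) = \int[mu]_(u in A) \int[m]_z k (u, z).
Proof.
transitivity (\int[m]_z \int[mu]_u g (u, z)).
  by apply: eq_integral => z _; rewrite integral_g.
have <- := @fubini_tonelli _ _ _ _ _ mu m g mg g0.
rewrite [RHS]integral_mkcond.
apply: eq_integral => u _; rewrite patchE.
under eq_integral do rewrite gE patchE.
by case: ifP => // _; rewrite integral0.
Qed.

End tonelli.

Section integral_itv.
Context {R : realType}.
Local Notation mu := (@lebesgue_measure R).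
Local Open Scope ereal_scope.

Lemma integral_itv_le (a b c : R) (f : R -> \bar R) : (a <= b)%R ->
  measurable_fun `[a, b] f -> (forall u, u \in `[a, b]%R -> 0 <= f u <= c%:E) ->
  \int[mu]_(u in `[a, b]) f u <= (c * (b - a))%:E.
Proof.
move=> ab mf fc; apply: (@le_trans _ _ (\int[mu]_(u in `[a, b]) c%:E)).
  apply: ge0_le_integral => //.
  - by move=> u /fc/andP[].
  - by move=> u /fc/andP[].
rewrite integral_cst//= lebesgue_measure_itv/= lte_fin.
case: ltP => [_|ba]; first by rewrite -EFinB -EFinM.
have -> : b = a by apply/le_anti/andP.
by rewrite subrr mulr0 mule0.
Qed.

Lemma integral_itv_shift (a b t : R) (f : R -> \bar R) :
  measurable_fun setT f -> (forall u, 0 <= f u) ->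
  \int[mu]_(u in `[(a + t)%R, (b + t)%R]) f u = \int[mu]_(u in `[a, b]) f (u + t)%R.
Proof.
move=> mf f0; rewrite integral_mkcond (integral_translation t)//; last 2 first.
- by apply/(measurable_restrictT _ (measurable_itv _)); exact: measurable_funTS.
- by move=> u; rewrite patchE; case: ifP.
rewrite [RHS]integral_mkcond; apply: eq_integral => u _; rewrite !patchE.
suff -> : ((u + t)%R \in `[(a + t)%R, (b + t)%R]%classic) = (u \in `[a, b]%classic) by [].
by apply/idP/idP => /set_mem/=; rewrite in_itv/= ?lerD2r => h; apply/mem_set;
  rewrite /= in_itv/= ?lerD2r.
Qed.

End integral_itv.

(** Here [f u z] is a kernel of time [u] with two time derivatives controlled by
    [q], and the integral of [G] against [q (u, _)] grows at most like [u^b]. As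
    the supremum of [q (u, z)] over the times [u] need not be integrable in [z],
    an increment in time is bounded by the time integral of the derivative bound,
    and Tonelli moves the integral in [z] inside the one in time. *)
Section time_regularity.
Context {R : realType} {d : nat}.
Local Notation mu := (@lebesgue_measure R).
Local Notation leb := (@lebesgue_rV R d).
Variables (f : R -> 'rV[R]_d -> R) (q : R * 'rV[R]_d -> R) (G : 'rV[R]_d -> R).
Variables (T C K b : R).
Hypotheses (mf : forall u, 0 < u -> measurable_fun setT (f u)).
Hypotheses (mq : measurable_fun setT q) (q0 : forall uz, 0 <= q uz).
Hypotheses (mG : measurable_fun setT G) (G0 : forall z, 0 <= G z).
Hypotheses (C0 : 0 <= C) (K0 : 0 <= K) (b1 : b <= 1).
Hypothesis qG : forall u, 0 < u <= T ->
  (\int[leb]_z (G z * q (u, z))%:E <= (K * u `^ b)%:E)%E.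
Hypothesis df : forall u z, 0 < u -> derivable (fun u => f u z) u 1.
Hypothesis ddf : forall u z, 0 < u ->
  derivable (derive1 (fun u => f u z)) u 1.
Hypothesis f1 : forall u z, 0 < u <= T ->
  `|derive1 (fun u => f u z) u| <= C * u `^ (- 1) * q (u, z).
Hypothesis f2 : forall u z, 0 < u <= T ->
  `|derive1n 2 (fun u => f u z) u| <= C * u `^ (- 2) * q (u, z).

Let kappa (k : R) (uz : R * 'rV[R]_d) : R := C * uz.1 `^ (- k) * q uz.

Let mkappa k : measurable_fun setT (kappa k).
Proof.
apply: measurable_funM => //; apply: measurable_funM => //.
exact: (measurableT_comp (measurable_powR _) measurable_fst).
Qed.

Let kappa0 k uz : 0 <= kappa k uz.
Proof. by rewrite mulr_ge0// mulr_ge0// powR_ge0. Qed.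

Let int_kappa k u s : 0 < s -> s <= u <= T -> 1 <= k ->
  (\int[leb]_z (G z * kappa k (u, z))%:E <= (C * K * s `^ (b - k))%:E)%E.
Proof.
move=> s0 /andP[su uT] k1; have u0 := lt_le_trans s0 su.
have cu : 0 <= C * u `^ (- k) by rewrite mulr_ge0// powR_ge0.
under eq_integral do rewrite /kappa/= mulrCA EFinM.
rewrite ge0_integralZl_EFin//; last 2 first.
- by move=> z _; rewrite lee_fin mulr_ge0.
- have mp : measurable_fun setT (fun z : 'rV[R]_d => (u, z)) by exact: measurable_fun_pair.
  apply/measurable_EFinP/measurable_funM => //; exact: (measurableT_comp mq mp).
have uT' : 0 < u <= T by rewrite u0.
apply: (le_trans (lee_wpmul2l _ (qG uT'))); first by rewrite lee_fin.
rewrite -EFinM lee_fin.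
have -> : C * u `^ (- k) * (K * u `^ b) = C * K * u `^ (b - k).
  by rewrite powRD ?(gt_eqF u0) ?implybT//; ring.
rewrite ler_wpM2l ?mulr_ge0//.
have bk : 0 <= k - b by rewrite subr_ge0 (le_trans b1).
rewrite -(opprB k) !powRN lef_pV2 ?posrE ?powR_gt0//.
by apply: ge0_ler_powR; rewrite ?nnegrE// ltW.
Qed.

Let mGkappa k : measurable_fun setT (fun uz : R * 'rV[R]_d => G uz.2 * kappa k uz).
Proof.
by apply: measurable_funM => //; exact: (measurableT_comp mG measurable_snd).
Qed.

Let mkappa1 k z : measurable_fun setT (fun u => (kappa k (u, z))%:E).
Proof.
have mp : measurable_fun setT (fun u : R => (u, z)) by exact: measurable_fun_pair.
by apply/measurable_EFinP; exact: (measurableT_comp (mkappa k) mp).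
Qed.

Let mGK k : measurable_fun setT
  (fun uz : R * 'rV[R]_d => (G uz.2 * kappa k uz)%:E).
Proof. by apply/measurable_EFinP; exact: mGkappa. Qed.

Let GK0 k uz : (0 <= (G uz.2 * kappa k uz)%:E)%E.
Proof. by rewrite lee_fin mulr_ge0. Qed.

Let mintGK k : measurable_fun setT
  (fun u => \int[leb]_z (G z * kappa k (u, z))%:E)%E.
Proof. exact: (@measurable_fun_fubini_tonelli_F _ _ _ _ _ leb _ (mGK k)). Qed.

Lemma kernel_increment_le s t : 0 < s -> s <= t <= T ->
  (\int[leb]_z (G z * `|f t z - f s z|)%:E <= (C * K * (t - s) * s `^ (b - 1))%:E)%E.
Proof.
move=> s0 /andP[st tT]; have t0 := lt_le_trans s0 st.
have mst : measurable `[s, t]%classic by exact: measurable_itv.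
apply: (@le_trans _ _ (\int[leb]_z \int[mu]_(u in `[s, t]) (G z * kappa 1 (u, z))%:E)%E).
  apply: ge0_le_integral => //.
  - by move=> z _; rewrite lee_fin mulr_ge0.
  - apply/measurable_EFinP/measurable_funM => //.
    by apply: measurableT_comp => //; apply: measurable_funB; exact: mf.
  - exact: (measurable_restricted_integral mst (mGK 1)).
  - move=> z _; under eq_integral do rewrite EFinM.
    rewrite ge0_integralZl_EFin//; last 2 first.
    + by move=> u _; rewrite lee_fin; exact: kappa0.
    + by apply: measurable_funTS; exact: mkappa1.
    rewrite EFinM; apply: lee_wpmul2l; first by rewrite lee_fin.
    apply: (@le_increment_integral R s t (f^~ z) (fun u => (kappa 1 (u, z))%:E) st).
    + by apply: measurable_funTS; exact: mkappa1.
    + by move=> u; rewrite in_itv/= => /andP[su _]; apply: df; exact: lt_le_trans su.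
    + move=> u; rewrite in_itv/= => /andP[su ut]; rewrite lee_fin.
      by apply: f1; rewrite (lt_le_trans s0 su) (le_trans ut).
rewrite (restricted_tonelli mst (mGK 1) (GK0 1)).
have -> : C * K * (t - s) * s `^ (b - 1) = C * K * s `^ (b - 1) * (t - s) by ring.
apply: integral_itv_le => //; first by apply: measurable_funTS; exact: mintGK.
move=> u; rewrite in_itv/= => /andP[su ut]; apply/andP; split.
  by apply: integral_ge0 => z _; exact: (GK0 1 (u, z)).
by apply: int_kappa => //; rewrite su (le_trans ut).
Qed.

(** The second difference is the increment over [[r - tau, r]] of
    [w |-> f (w + tau) z - f w z], whose derivative is itself an increment of the
    time derivative of [f]. *)
Lemma kernel_second_difference_le r tau : 0 < tau < r -> r + tau <= T ->
  (\int[leb]_z (G z * `|f (r + tau) z - 2 * f r z + f (r - tau) z|)%:E <=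
   (C * K * tau ^+ 2 * (r - tau) `^ (b - 2))%:E)%E.
Proof.
move=> /andP[tau0 taur] rT; pose a := r - tau.
have a0 : 0 < a by rewrite subr_gt0.
have ar : a <= r by rewrite /a; lra.
have mar : measurable `[a, r]%classic by exact: measurable_itv.
have m0tau : measurable `[0, tau]%classic by exact: measurable_itv.
(* The increment of the time derivative over [[w, w + tau]], with the
   integration variable shifted to the fixed interval [[0, tau]]. *)
pose k2 (wz : R * 'rV[R]_d) :=
  (\int[mu]_(u in `[0%R, tau]) (G wz.2 * kappa 2 ((u + wz.1)%R, wz.2))%:E)%E.
pose k3 (uwz : R * (R * 'rV[R]_d)) :=
  (G uwz.2.2 * kappa 2 (uwz.1 + uwz.2.1, uwz.2.2))%:E.
have mk3 : measurable_fun setT k3.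
  have msh : measurable_fun setT
      (fun uwz : R * (R * 'rV[R]_d) => (uwz.1 + uwz.2.1, uwz.2.2)).
    apply: measurable_fun_pair.
      apply: measurable_funD => //.
      exact: (measurableT_comp measurable_fst measurable_snd).
    exact: (measurableT_comp measurable_snd measurable_snd).
  exact: (measurableT_comp (mGK 2) msh).
have k30 uwz : (0 <= k3 uwz)%E.
  by exact: (GK0 2 (uwz.1 + uwz.2.1, uwz.2.2)).
have mk2 : measurable_fun setT k2 by exact: (measurable_restricted_integral m0tau mk3 k30).
have k20 wz : (0 <= k2 wz)%E by apply: integral_ge0 => u _; exact: (k30 (u, wz)).
apply: (@le_trans _ _ (\int[leb]_z \int[mu]_(w in `[a, r]) k2 (w, z))%E).
  apply: ge0_le_integral => //.
  - by move=> z _; rewrite lee_fin mulr_ge0.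
  - apply/measurable_EFinP/measurable_funM => //.
    apply: measurableT_comp => //; apply: measurable_funD; last exact: mf.
    apply: measurable_funB; first by apply: mf; lra.
    by apply: measurable_funM => //; apply: mf; lra.
  - exact: (measurable_restricted_integral mar mk2).
  - move=> z _.
    pose k4 w := (\int[mu]_(u in `[0%R, tau]) (kappa 2 ((u + w)%R, z))%:E)%E.
    have mk4 : measurable_fun setT k4.
      apply: (@measurable_restricted_integral R _ _ `[0%R, tau]%classic
        (fun uw : R * R => (kappa 2 ((uw.1 + uw.2)%R, z))%:E)) => //; last first.
        by move=> uw; rewrite lee_fin; exact: kappa0.
      apply: (measurableT_comp (mkappa1 2 z)).
      exact: measurable_funD.
    have k40 w : (0 <= k4 w)%E.
      by apply: integral_ge0 => u _; rewrite lee_fin; exact: kappa0.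
    have mkap (w : R) : measurable_fun setT (fun u : R => (kappa 2 (u + w, z))%:E).
      by apply: (measurableT_comp (mkappa1 2 z)); exact: measurable_funD.
    have k2E w : k2 (w, z) = ((G z)%:E * k4 w)%E.
      rewrite /k2 /k4/=; under eq_integral do rewrite EFinM.
      rewrite ge0_integralZl_EFin//.
      + by move=> u _; rewrite lee_fin; exact: kappa0.
      + by apply: measurable_funTS; exact: mkap.
    under eq_integral do rewrite k2E.
    rewrite ge0_integralZl_EFin//; last exact: measurable_funTS.
    rewrite EFinM; apply: lee_wpmul2l; first by rewrite lee_fin.
    pose g w := f (w + tau) z - f w z.
    have dft (w : R) : 0 < w -> is_derive w 1 (fun w : R => f (w + tau) z)
        (derive1 (f^~ z) (w + tau)).
      move=> w0; have wt0 : 0 < w + tau by lra.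
      have Df : is_derive (w + tau) 1 (f^~ z) (derive1 (f^~ z) (w + tau)).
        by rewrite derive1E; exact/derivableP/df.
      have Ds : is_derive w 1 (fun w : R => w + tau) 1.
        by apply: is_derive_eq; rewrite addr0.
      by have := is_derive1_comp (f := f^~ z) (g := fun w : R => w + tau) Df Ds; rewrite mulr1.
    have dg (w : R) : 0 < w -> is_derive w 1 g
        (derive1 (f^~ z) (w + tau) - derive1 (f^~ z) w).
      move=> w0; apply: is_deriveB; first exact: dft.
      by rewrite derive1E; exact/derivableP/df.
    have -> : f (r + tau) z - 2 * f r z + f (r - tau) z = g r - g a.
      by rewrite /g /a subrK; ring.
    apply: (@le_increment_integral R a r g k4 ar); first exact: measurable_funTS.
    + by move=> w; rewrite in_itv/= => /andP[aw _]; have [] := dg w (lt_le_trans a0 aw).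
    + move=> w; rewrite in_itv/= => /andP[aw wr]; have w0 := lt_le_trans a0 aw.
      rewrite derive1E; have [_ ->] := dg w w0.
      rewrite /k4 -(@integral_itv_shift _ 0 tau w (fun u => (kappa 2 (u, z))%:E))//;
        last by move=> u; rewrite lee_fin; exact: kappa0.
      rewrite add0r [tau + w]addrC.
      apply: (@le_increment_integral R w (w + tau) (derive1 (f^~ z))); first by lra.
      * exact: measurable_funTS.
      * by move=> u; rewrite in_itv/= => /andP[wu _]; apply: ddf; lra.
      * move=> u; rewrite in_itv/= => /andP[wu uw]; rewrite lee_fin.
        by apply: f2; apply/andP; split; lra.
rewrite (restricted_tonelli mar mk2 k20).
have -> : C * K * tau ^+ 2 * (r - tau) `^ (b - 2) =
    C * K * a `^ (b - 2) * tau * (r - a) by rewrite /a; ring.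
have k2int w : (\int[leb]_z k2 (w, z) =
    \int[mu]_(u in `[0%R, tau]) \int[leb]_z (G z * kappa 2 ((u + w)%R, z))%:E)%E.
  rewrite /k2/= (@restricted_tonelli R _ _ `[0%R, tau]%classic
    (fun uz => (G uz.2 * kappa 2 ((uz.1 + w)%R, uz.2))%:E))//; last first.
    by move=> uz; exact: (GK0 2 (uz.1 + w, uz.2)).
  have msh : measurable_fun setT (fun uz : R * 'rV[R]_d => (uz.1 + w, uz.2)).
    by apply: measurable_fun_pair => //; exact: measurable_funD.
  exact: (measurableT_comp (mGK 2) msh).
have mwint : measurable_fun setT (fun w : R => \int[leb]_z k2 (w, z))%E.
  exact: (@measurable_fun_fubini_tonelli_F _ _ _ _ _ leb k2).
apply: integral_itv_le => //; first exact: measurable_funTS.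
move=> w; rewrite in_itv/= => /andP[aw wr]; apply/andP; split.
  by apply: integral_ge0.
rewrite k2int -[tau in X in (_ <= X)%E]subr0.
apply: integral_itv_le; first exact: ltW.
  apply: measurable_funTS; apply: (measurableT_comp (mintGK 2)).
  exact: measurable_funD.
move=> u; rewrite in_itv/= => /andP[u0 ut]; apply/andP; split.
  by apply: integral_ge0 => z _; exact: (GK0 2 (u + w, z)).
apply: int_kappa => //; last by rewrite ler1n.
by apply/andP; split; lra.
Qed.

End time_regularity.

(** * Second moments of the increments of [h (X t)] *)

Section increment_moments.
Context {R : realType} {d : nat} {dO : measure_display} {Omega : measurableType dO}.
Variables (X : R -> Omega -> 'rV[R]_d) (P : 'rV[R]_d -> probability Omega R).
Variable p : R -> 'rV[R]_d -> 'rV[R]_d -> R.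
Variables (T C alpha gamma : R) (Q h : 'rV[R]_d -> R).
Hypotheses (d0 : (0 < d)%N) (mX : markov_process X P) (pX : transition_density X P p).
Hypothesis dp : forall t x y, 0 < t -> derivable (fun s => p s x y) t 1.
Hypothesis ddp : forall t x y, 0 < t -> derivable (derive1 (fun s => p s x y)) t 1.
Hypotheses (C0 : 0 <= C) (alpha0 : 0 < alpha) (densQ : is_density Q).
Hypothesis p0 : forall t x y, 0 < t <= T ->
  p t x y <= C * t `^ (- (d%:R / alpha)) * Q (t `^ (- alpha^-1) *: (x - y)).
Hypothesis p1 : forall t x y, 0 < t <= T ->
  `| derive1 (fun s => p s x y) t | <=
    C * t `^ (- 1 - d%:R / alpha) * Q (t `^ (- alpha^-1) *: (x - y)).
Hypothesis p2 : forall t x y, 0 < t <= T ->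
  `| derive1n 2 (fun s => p s x y) t | <=
    C * t `^ (- 2 - d%:R / alpha) * Q (t `^ (- alpha^-1) *: (x - y)).
Hypotheses (gamma0 : 0 < gamma) (gammaalpha : gamma <= alpha / 2).
Hypothesis momoo : (moment Q (2 * gamma) < +oo)%E.
Hypothesis hoo : (holder_seminorm gamma h < +oo)%E.
Implicit Types (x y z : 'rV[R]_d) (r s t u v : R).
Local Notation leb := (lebesgue_rV d).
Local Notation M := (fine (moment Q (2 * gamma))).
Local Notation H := (fine (holder_seminorm gamma h)).
Local Notation beta := (2 * gamma / alpha).
Local Notation K := (H ^+ 2 * M).
Let G y z : R := (h z - h y) ^+ 2.
Let q y (uz : R * 'rV[R]_d) := rescaled alpha Q uz.1 (y - uz.2).

Let mQ : measurable_fun setT Q. Proof. by have [] := densQ. Qed.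
Let Q0 z : 0 <= Q z. Proof. by have [_ + _] := densQ; exact. Qed.
Let mh : measurable_fun setT h. Proof. exact: (measurable_holder gamma0 hoo d0). Qed.
Let q0 y uz : 0 <= q y uz. Proof. exact: rescaled_ge0. Qed.
Let mq y : measurable_fun setT (q y). Proof. exact: measurable_rescaled. Qed.
Let G0 y z : 0 <= G y z. Proof. exact: sqr_ge0. Qed.
Let mG y : measurable_fun setT (G y).
Proof. by apply: measurable_funX; apply: measurable_funB. Qed.
Let mq1 y u : measurable_fun setT (fun z => q y (u, z)).
Proof.
have mp : measurable_fun setT (fun z : 'rV[R]_d => (u, z)) by exact: measurable_fun_pair.
exact: (measurableT_comp (mq y) mp).
Qed.

Let M0 : 0 <= M.
Proof.
rewrite fine_ge0//; apply: integral_ge0 => z _.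
by rewrite lee_fin mulr_ge0 ?powR_ge0.
Qed.

Let K0 : 0 <= K. Proof. by rewrite mulr_ge0 ?sqr_ge0. Qed.

Let beta1 : beta <= 1.
Proof. by rewrite ler_pdivrMr// mul1r; move: gammaalpha; rewrite ler_pdivlMr// mulrC. Qed.

Let G_le y z : G y z <= H ^+ 2 * enorm (y - z) `^ (2 * gamma).
Proof.
have -> : enorm (y - z) `^ (2 * gamma) = (enorm (y - z) `^ gamma) ^+ 2.
  by rewrite mulrC powRrM powR_mulrn// powR_ge0.
rewrite -exprMn /G -real_normK ?num_real// distrC.
by rewrite lerXn2r ?nnegrE ?mulr_ge0 ?powR_ge0 ?holder_seminorm_ge0// holder_seminorm_le.
Qed.

Local Open Scope ereal_scope.

Let moment_fin : moment Q (2 * gamma) = M%:E.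
Proof.
rewrite fineK// ge0_fin_numE//; apply: integral_ge0 => z _.
by rewrite lee_fin mulr_ge0 ?powR_ge0.
Qed.

Let qG y u : (0 < u <= T)%R ->
  \int[leb]_z (G y z * q y (u, z))%:E <= (K * u `^ beta)%:E.
Proof.
move=> /andP[u0 _].
have mE : measurable_fun setT (fun z => enorm (y - z) `^ (2 * gamma))%R.
  apply: (measurableT_comp (measurable_powR _)).
  apply: (measurableT_comp measurable_enorm).
  have mp : measurable_fun setT (fun z : 'rV[R]_d => (y, z)) by exact: measurable_fun_pair.
  exact: (measurableT_comp measurable_rV_sub mp).
apply: (@le_trans _ _ (\int[leb]_z
    ((H ^+ 2)%:E * (enorm (y - z) `^ (2 * gamma) * q y (u, z))%:E))).
  apply: ge0_le_integral => //.
  - by move=> z _; rewrite lee_fin mulr_ge0.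
  - by apply/measurable_EFinP/measurable_funM.
  - by apply: emeasurable_funM => //; apply/measurable_EFinP/measurable_funM.
  - by move=> z _; rewrite -EFinM lee_fin [leRHS]mulrA; apply: ler_wpM2r.
rewrite ge0_integralZl_EFin ?sqr_ge0//; last 2 first.
- by move=> z _; rewrite lee_fin mulr_ge0 ?powR_ge0.
- by apply/measurable_EFinP/measurable_funM.
rewrite /q/= integral_rescaled_moment// moment_fin -!EFinM lee_fin.
by rewrite [(u `^ _ * M)%R]mulrC mulrA.
Qed.

Let qone y u : (0 < u <= T)%R ->
  \int[leb]_z (1 * q y (u, z))%:E <= (1 * u `^ 0)%:E.
Proof.
move=> /andP[u0 _]; rewrite powRr0 mul1r.
under eq_integral do rewrite mul1r.
by rewrite /q/= integral_rescaled.
Qed.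

Let pq1 y u z : (0 < u <= T)%R ->
  (`|derive1 (fun u => p u y z) u| <= C * u `^ (- 1) * q y (u, z))%R.
Proof.
move=> uT; have /andP[u0 _] := uT; apply: le_trans (p1 y z uT) _.
by rewrite powRD ?(gt_eqF u0) ?implybT// /q /rescaled/= !mulrA.
Qed.

Let pq2 y u z : (0 < u <= T)%R ->
  (`|derive1n 2 (fun u => p u y z) u| <= C * u `^ (- 2) * q y (u, z))%R.
Proof.
move=> uT; have /andP[u0 _] := uT; apply: le_trans (p2 y z uT) _.
by rewrite powRD ?(gt_eqF u0) ?implybT// /q /rescaled/= !mulrA.
Qed.

Let mp u y : (0 < u)%R -> measurable_fun setT (p u y).
Proof. exact: (measurable_density pX). Qed.
Let pge0 u y z : (0 < u)%R -> (0 <= p u y z)%R.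
Proof. exact: (density_ge0 pX). Qed.

(** For [r > 0], the second moment of [h (X r) - h y] under [P y]. *)
Definition conditional_moment r y := \int[leb]_z (G y z * p r y z)%:E.
Local Notation Phi := conditional_moment.

Let Phi_ge0 r y : (0 < r)%R -> 0 <= Phi r y.
Proof. by move=> r0; apply: integral_ge0 => z _; rewrite lee_fin mulr_ge0 ?pge0. Qed.

Let Phi_le r y : (0 < r <= T)%R -> Phi r y <= (C * K * r `^ beta)%:E.
Proof.
move=> rT; have /andP[r0 _] := rT.
apply: (@le_trans _ _ (\int[leb]_z (C%:E * (G y z * q y (r, z))%:E))).
  apply: ge0_le_integral => //.
  - by move=> z _; rewrite lee_fin mulr_ge0 ?pge0.
  - by apply/measurable_EFinP/measurable_funM => //; exact: mp.
  - by apply: emeasurable_funM => //; apply/measurable_EFinP/measurable_funM.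
  - move=> z _; rewrite -EFinM lee_fin mulrCA ler_wpM2l//.
    by apply: le_trans (p0 y z rT) _; rewrite /q /rescaled/= mulrA.
rewrite ge0_integralZl_EFin//; last 2 first.
- by move=> z _; rewrite lee_fin mulr_ge0.
- by apply/measurable_EFinP/measurable_funM.
by rewrite -mulrA [X in _ <= X]EFinM; apply: lee_wpmul2l => //; exact: qG.
Qed.

Let integral_le_add (y : 'rV[R]_d) (f1 f2 g : 'rV[R]_d -> R) (B : R) :
  measurable_fun setT f1 -> measurable_fun setT f2 -> measurable_fun setT g ->
  (forall z, 0 <= f1 z)%R -> (forall z, 0 <= f2 z)%R -> (forall z, 0 <= g z)%R ->
  (forall z, f1 z <= f2 z + g z)%R ->
  \int[leb]_z (G y z * g z)%:E <= B%:E ->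
  \int[leb]_z (G y z * f1 z)%:E <= \int[leb]_z (G y z * f2 z)%:E + B%:E.
Proof.
move=> mf1 mf2 mg f10 f20 g0 fg gB.
have mGf (f : 'rV[R]_d -> R) : measurable_fun setT f ->
    measurable_fun setT (fun z => (G y z * f z)%:E).
  by move=> mf; apply/measurable_EFinP/measurable_funM.
apply: (@le_trans _ _ (\int[leb]_z ((G y z * f2 z)%:E + (G y z * g z)%:E))).
  apply: ge0_le_integral => //.
  - by move=> z _; rewrite lee_fin mulr_ge0.
  - exact: mGf.
  - by apply: emeasurable_funD; exact: mGf.
  - by move=> z _; rewrite -EFinD lee_fin -mulrDr ler_wpM2l.
rewrite ge0_integralD//.
- by apply: leeD.
- by move=> z _; rewrite lee_fin mulr_ge0.
- exact: mGf.
- by move=> z _; rewrite lee_fin mulr_ge0.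
- exact: mGf.
Qed.

Let B1 (tau m : R) := (C * K * tau * m `^ (beta - 1))%R.
Let B2 (tau m : R) := (C * K * tau ^+ 2 * m `^ (beta - 2))%R.

Let Phi_increment s t y : (0 < s)%R -> (s <= t <= T)%R ->
  Phi s y <= Phi t y + (B1 (t - s) s)%:E /\ Phi t y <= Phi s y + (B1 (t - s) s)%:E.
Proof.
move=> s0 stT; have /andP[st _] := stT; have t0 := lt_le_trans s0 st.
have inc := @kernel_increment_le R d (fun u => p u y) (q y) (G y) T C K beta
  (fun u => @mp u y) (mq y) (q0 y) (mG y) (G0 y) C0 K0 beta1 (@qG y)
  (fun u z => @dp u y z) (@pq1 y) s t s0 stT.
have mpst : measurable_fun setT (fun z => `|p t y z - p s y z|)%R.
  by apply: measurableT_comp => //; apply: measurable_funB; exact: mp.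
split.
  apply: (integral_le_add (@mp s y s0) (@mp t y t0) mpst _ _ _ _ inc) => z //; try exact: pge0.
  by rewrite -lerBlDl distrC ler_norm.
apply: (integral_le_add (@mp t y t0) (@mp s y s0) mpst _ _ _ _ inc) => z //; try exact: pge0.
by rewrite -lerBlDl ler_norm.
Qed.

Let Phi_second_difference r tau y : (0 < tau < r)%R -> (r + tau <= T)%R ->
  Phi (r + tau) y + Phi (r - tau) y <= Phi r y + Phi r y + (B2 tau (r - tau))%:E.
Proof.
move=> taur rT; have /andP[tau0 taur'] := taur.
have inc := @kernel_second_difference_le R d (fun u => p u y) (q y) (G y) T C K beta
  (fun u => @mp u y) (mq y) (q0 y) (mG y) (G0 y) C0 K0 beta1 (@qG y)
  (fun u z => @dp u y z) (fun u z => @ddp u y z) (@pq2 y) r tau taur rT.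
have r0 : (0 < r)%R by lra.
have rt0 : (0 < r + tau)%R by lra.
have rmt0 : (0 < r - tau)%R by lra.
have PhiD u v : (0 < u)%R -> (0 < v)%R ->
    Phi u y + Phi v y = \int[leb]_z (G y z * (p u y z + p v y z))%:E.
  move=> u0 v0; rewrite -ge0_integralD//; last 4 first.
  - by move=> z _; rewrite lee_fin mulr_ge0// pge0.
  - by apply/measurable_EFinP/measurable_funM => //; exact: mp.
  - by move=> z _; rewrite lee_fin mulr_ge0// pge0.
  - by apply/measurable_EFinP/measurable_funM => //; exact: mp.
  by apply: eq_integral => z _; rewrite -EFinD mulrDr.
rewrite !PhiD//; apply: integral_le_add inc.
- by apply: measurable_funD; exact: mp.
- by apply: measurable_funD; exact: mp.
- apply: measurableT_comp => //; apply: measurable_funD; last exact: mp.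
  by apply: measurable_funB; [|apply: measurable_funM => //]; exact: mp.
- by move=> z; rewrite addr_ge0// pge0.
- by move=> z; rewrite addr_ge0// pge0.
- by [].
- move=> z; rewrite -lerBlDl; apply: le_trans (ler_norm _).
  by rewrite le_eqVlt; apply/orP; left; apply/eqP; ring.
Qed.

Let p_increment a t x : (0 < a)%R -> (a <= t <= T)%R ->
  \int[leb]_y (`|p t x y - p a x y|)%:E <= (C * (t - a) / a)%:E.
Proof.
move=> a0 aT.
have := @kernel_increment_le R d (fun u => p u x) (q x) (fun=> 1%R) T C 1 0
  (fun u => @mp u x) (mq x) (q0 x) (measurable_cst _) (fun=> ler01) C0 ler01 ler01 (@qone x)
  (fun u z => @dp u x z) (@pq1 x) a t a0 aT.
rewrite mulr1 sub0r powRN powRr1; last exact: ltW.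
suff -> : \int[leb]_y (`|p t x y - p a x y|)%:E =
    \int[leb]_y (1 * `|p t x y - p a x y|)%:E by [].
by apply: eq_integral => y _; rewrite mul1r.
Qed.

Let p_mass u x : (0 < u)%R -> \int[leb]_y (p u x y)%:E = 1.
Proof.
move=> u0; have [_ _ /(_ x setT measurableT) <-] := pX u0.
by rewrite preimage_setT probability_setT.
Qed.

Let F (yz : 'rV[R]_d * 'rV[R]_d) : \bar R := (G yz.1 yz.2)%:E.
Let mF : measurable_fun setT F.
Proof.
apply/measurable_EFinP; apply: measurable_funX; apply: measurable_funB.
  exact: (measurableT_comp mh measurable_snd).
exact: (measurableT_comp mh measurable_fst).
Qed.
Let F0 yz : 0 <= F yz. Proof. by rewrite lee_fin. Qed.

Definition increment_moment x u v := \int[P x]_w ((h (X v w) - h (X u w)) ^+ 2)%:E.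
Local Notation V := increment_moment.

Let V_density x u v : (0 < u < v)%R ->
  V x u v = \int[leb]_y ((p u x y)%:E * Phi (v - u) y).
Proof.
move=> uv; rewrite /increment_moment -/(F (_, _)).
rewrite (expect_two_time mX pX x uv mF F0).
apply: eq_integral => y _; congr (_ * _); apply: eq_integral => z _.
by rewrite /F/= -EFinM mulrC.
Qed.

Let measurable_Phi r : (0 < r)%R -> measurable_fun setT (Phi r).
Proof.
move=> r0.
have mk : measurable_fun setT
    (fun yz : 'rV[R]_d * 'rV[R]_d => (G yz.1 yz.2 * p r yz.1 yz.2)%:E).
  apply/measurable_EFinP; apply: measurable_funM; last by have [] := pX r0.
  by have /measurable_EFinP := mF.
apply: (@measurable_fun_fubini_tonelli_F _ _ _ _ _ leb _ mk) => yz.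
by rewrite lee_fin mulr_ge0// pge0.
Qed.

Lemma increment_moment_le x u v : (0 <= u < v)%R -> (v - u <= T)%R ->
  V x u v <= (C * K * (v - u) `^ beta)%:E.
Proof.
move=> /andP[u0 uv] vuT.
have vuT' : (0 < v - u <= T)%R by rewrite subr_gt0 uv.
have vu0 : (0 < v - u)%R by rewrite subr_gt0.
have [u0'|u0'] := leP u 0%R.
  have E : u = 0%R by apply/le_anti; rewrite u0'.
  subst u; rewrite subr0 in vuT vuT' vu0 *.
  rewrite /increment_moment.
  have -> : \int[P x]_w ((h (X v w) - h (X 0%R w)) ^+ 2)%:E =
      \int[P x]_w F (X 0%R w, X v w) by [].
  rewrite (expect_start mX x (ltW vu0) mF F0).
  have mFx : measurable_fun setT (fun z => F (x, z)).
    have mp' : measurable_fun setT (fun z : 'rV[R]_d => (x, z)) by exact: measurable_fun_pair.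
    exact: (measurableT_comp mF mp').
  rewrite (expect_density mX pX x vu0 mFx) => [|z]; last exact: F0.
  apply: le_trans (Phi_le x vuT').
  rewrite le_eqVlt; apply/orP; left; apply/eqP; apply: eq_integral => z _.
  by rewrite /F -EFinM mulrC.
rewrite V_density ?u0'//.
apply: (@le_trans _ _ (\int[leb]_y ((C * K * (v - u) `^ beta)%:E * (p u x y)%:E))).
  apply: ge0_le_integral => //.
  - by move=> y _; rewrite mule_ge0 ?Phi_ge0// lee_fin pge0.
  - apply: emeasurable_funM; last exact: measurable_Phi.
    by apply/measurable_EFinP; exact: mp.
  - by apply: emeasurable_funM => //; apply/measurable_EFinP; exact: mp.
  - move=> y _; rewrite muleC; apply: lee_wpmul2r; first by rewrite lee_fin pge0.
    exact: Phi_le.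
rewrite ge0_integralZl_EFin//.
- by rewrite p_mass// mule1.
- by move=> y _; rewrite lee_fin pge0.
- by apply/measurable_EFinP; exact: mp.
- by rewrite mulr_ge0 ?powR_ge0// mulr_ge0.
Qed.

(** With [s = a + tau] and [t = b + tau], the combination
    [V(a,t) + V(s,b) - V(a,b) - V(s,t)] is twice the expected product of the
    increments over [[a, s]] and [[b, t]]. It equals
    [int p_a (Phi_{r+tau} - 2 Phi_r + Phi_{r-tau}) + int (p_s - p_a)
    (Phi_{r-tau} - Phi_r)] with [r = b - a]: a second difference in time, plus a
    product of two first differences. *)
Lemma increment_moment_cross x a b tau : (0 < a)%R -> (0 < tau)%R ->
  (a + tau < b)%R -> (b + tau <= T)%R ->
  V x a (b + tau) + V x (a + tau) b <=
  V x a b + V x (a + tau) (b + tau) +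
  (C * K * (tau ^+ 2 * (b - a - tau) `^ (beta - 2) +
     C * tau / a * (tau * (b - a - tau) `^ (beta - 1))))%:E.
Proof.
move=> a0 tau0 ab bT; pose r := (b - a)%R.
have r0 : (0 < r)%R by rewrite /r; lra.
have rt : (0 < tau < r)%R by rewrite /r; apply/andP; split; lra.
have rm0 : (0 < r - tau)%R by rewrite /r; lra.
have rp0 : (0 < r + tau)%R by lra.
have s0 : (0 < a + tau)%R by lra.
rewrite !V_density; try by apply/andP; split; lra.
have -> : (b + tau - a = r + tau)%R by rewrite /r; ring.
have -> : (b - (a + tau) = r - tau)%R by rewrite /r; ring.
have -> : (b + tau - (a + tau) = r)%R by rewrite /r; ring.
rewrite -/r; set D2 := B2 tau (r - tau); set D1 := B1 tau (r - tau).
have mterm u v : (0 < u)%R -> (0 < v)%R ->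
    measurable_fun setT (fun y => (p u x y)%:E * Phi v y).
  move=> u0 v0; apply: emeasurable_funM; last exact: measurable_Phi.
  by apply/measurable_EFinP; exact: mp.
have term0 u v y : (0 < u)%R -> (0 < v)%R -> 0 <= (p u x y)%:E * Phi v y.
  by move=> u0 v0; rewrite mule_ge0 ?Phi_ge0// lee_fin pge0.
have D10 : (0 <= D1)%R.
  apply: mulr_ge0; [apply: mulr_ge0; [exact: mulr_ge0|exact: ltW]|exact: powR_ge0].
have D20 : (0 <= D2)%R.
  apply: mulr_ge0; [apply: mulr_ge0; [exact: mulr_ge0|exact: sqr_ge0]|exact: powR_ge0].
have mpa : measurable_fun setT (fun y => (p a x y)%:E).
  by apply/measurable_EFinP; exact: mp.
have mps : measurable_fun setT (fun y => `|p (a + tau) x y - p a x y|%:E).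
  apply/measurable_EFinP; apply: measurableT_comp => //.
  by apply: measurable_funB; exact: mp.
pose rest y := D2%:E * (p a x y)%:E + D1%:E * `|p (a + tau) x y - p a x y|%:E.
have rest0 y : 0 <= rest y.
  by rewrite adde_ge0// mule_ge0// lee_fin// pge0.
have mrest : measurable_fun setT rest.
  by apply: emeasurable_funD; apply: emeasurable_funM.
have int_rest : \int[leb]_y rest y <= (D2 + D1 * (C * tau / a))%:E.
  rewrite ge0_integralD//; last 4 first.
  - by move=> y _; rewrite mule_ge0 ?lee_fin ?pge0.
  - exact: emeasurable_funM.
  - by move=> y _; rewrite mule_ge0 ?lee_fin.
  - exact: emeasurable_funM.
  rewrite !ge0_integralZl_EFin//; last by move=> y _; rewrite lee_fin pge0.
  rewrite p_mass// mule1 EFinD leeD2l// [(D1 * _)%:E]EFinM.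
  apply: lee_wpmul2l; first by rewrite lee_fin.
  have := @p_increment a (a + tau) x a0.
  rewrite (addrC a) addrK; apply; apply/andP; split; lra.
have pointwise y : (p a x y)%:E * Phi (r + tau) y + (p (a + tau) x y)%:E * Phi (r - tau) y
    <= (p a x y)%:E * Phi r y + (p (a + tau) x y)%:E * Phi r y + rest y.
  have fin v : (0 < v <= T)%R -> exists2 phi : R, Phi v y = phi%:E & (0 <= phi)%R.
    move=> vT; have /andP[v0 _] := vT.
    have := Phi_le y vT; have := Phi_ge0 y v0.
    case: (Phi v y) => [phi||]//; rewrite !lee_fin => phi0 _.
    by exists phi.
  have [|f1 E1 f10] := fin (r + tau)%R; first by rewrite rp0 /r; lra.
  have [|f2 E2 f20] := fin (r - tau)%R; first by rewrite rm0 /r; lra.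
  have [|f3 E3 f30] := fin r; first by rewrite r0 /r; lra.
  have rT : (r + tau <= T)%R by rewrite /r; lra.
  have := Phi_second_difference y rt rT.
  have rmT : (r - tau <= r <= T)%R by apply/andP; split; rewrite /r; lra.
  have := Phi_increment y rm0 rmT.
  have -> : (r - (r - tau) = tau)%R by ring.
  rewrite -/D1 -/D2 E1 E2 E3 /rest -!EFinM -!EFinD !lee_fin => -[i1 i2] i3.
  have pa0 : (0 <= p a x y)%R by exact: pge0.
  rewrite -subr_ge0.
  have [ps|ps] := ger0P (p (a + tau) x y - p a x y)%R; nra.
apply: (@le_trans _ _ (\int[leb]_y ((p a x y)%:E * Phi r y +
    (p (a + tau) x y)%:E * Phi r y + rest y))).
  rewrite -ge0_integralD//; try by move=> y _; exact: term0.
  - apply: ge0_le_integral => //.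
    + by move=> y _; rewrite adde_ge0// term0.
    + by apply: emeasurable_funD; exact: mterm.
    + by apply: emeasurable_funD => //; apply: emeasurable_funD; exact: mterm.
  - exact: mterm.
  - exact: mterm.
rewrite ge0_integralD//; last 2 first.
- by move=> y _; rewrite adde_ge0// term0.
- by apply: emeasurable_funD; exact: mterm.
rewrite ge0_integralD//; try (by move=> y _; exact: term0); try exact: mterm.
rewrite leeD2l//; apply: le_trans int_rest _; rewrite lee_fin /D2 /D1 /B2 /B1.
set m2 := (_ `^ _)%R; set m1 := (_ `^ _)%R.
by rewrite le_eqVlt; apply/orP; left; apply/eqP; field; exact: lt0r_neq0.
Qed.

End increment_moments.

(** * Sums of powers *)

Section sums_of_powers.
Context {R : realType}.
Implicit Types (b y : R) (n N L : nat).

(** Concavity of the logarithm at the points [y] and [1], with weights [b] and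
    [1 - b]: the tangent inequality [ln t <= t - 1] is used at [y / z] and [1 / z],
    where [z] is the weighted mean. *)
Lemma bernoulli_powR b y : 0 <= b <= 1 -> 0 < y -> y `^ b <= 1 + b * (y - 1).
Proof.
move=> /andP[b0 b1] y0; set z := 1 + b * (y - 1).
have z0 : 0 < z by rewrite /z; nra.
rewrite -ler_ln ?posrE ?powR_gt0// ln_powR.
have lnyz : ln (y / z) <= y / z - 1.
  by rewrite -{1}(subrK 1 (y / z)) addrC le_ln1Dx// ltrBrDl subrr divr_gt0.
have ln1z : ln z^-1 <= z^-1 - 1.
  by rewrite -{1}(subrK 1 z^-1) addrC le_ln1Dx// ltrBrDl subrr invr_gt0.
rewrite ln_div ?posrE// in lnyz; rewrite lnV ?posrE// in ln1z.
have E : b * (y / z) + (1 - b) * z^-1 = 1.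
  by rewrite /z in z0 *; field; rewrite gt_eqF.
have := ler_wpM2l b0 lnyz; have : 0 <= 1 - b by rewrite subr_ge0.
move=> b1' i1; have := ler_wpM2l b1' ln1z; nra.
Qed.

(** This makes the sum of the [j.+1 `^ (b - 1)] telescope. *)
Lemma powR_le_increment b (j : nat) : 0 < b <= 1 ->
  b * j.+1%:R `^ (b - 1) <= j.+1%:R `^ b - j%:R `^ b.
Proof.
move=> /andP[b0 b1]; have j0 : 0 < j.+1%:R :> R by rewrite ltr0n.
rewrite powRB ?(gt_eqF j0) ?implybT// powRr1 ?(ltW j0)//.
case: j j0 => [|j] j0.
  have b0' : b != 0 by rewrite gt_eqF.
  by rewrite mulr0n powR0// mulr1n powR1 subr0 divr1 mulr1.
set J := j.+2%:R in j0 *.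
have -> : j.+1%:R = J * ((J - 1) / J) :> R.
  by rewrite mulrC divfK ?gt_eqF// /J -[j.+2%:R]natr1 addrK.
have y0 : 0 < (J - 1) / J by rewrite divr_gt0// /J -[_.+2%:R]natr1 addrK ltr0n.
rewrite powRM ?(ltW j0) ?(ltW y0)// -[X in _ <= X - _]mulr1 -mulrBr mulrCA; apply: ler_wpM2l.
  exact: powR_ge0.
have := @bernoulli_powR b ((J - 1) / J) _ y0; rewrite (ltW b0) b1 => /(_ isT) i1.
have -> : b / J = - (b * ((J - 1) / J - 1)) by field; rewrite gt_eqF.
move: i1; set u := _ `^ b; set v := b * _ => i1.
by lra.
Qed.

Lemma sum_powR_le b L : 0 < b <= 1 ->
  \sum_(0 <= j < L) j.+1%:R `^ (b - 1) <= L%:R `^ b / b.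
Proof.
move=> bP; have /andP[b0 _] := bP; elim: L => [|L IH].
  by rewrite big_geq// divr_ge0 ?powR_ge0// (ltW b0).
rewrite big_nat_recr//= ler_pdivlMr// mulrDl; rewrite ler_pdivlMr// in IH.
by have := powR_le_increment L bP; rewrite mulrC; lra.
Qed.

Lemma sum_inv_le L : (0 < L)%N -> \sum_(0 <= j < L) j.+1%:R^-1 <= 1 + ln L%:R :> R.
Proof.
elim: L => // -[|L] IH _; first by rewrite big_nat1 ln1 addr0 invr1.
rewrite big_nat_recr//=; have {}IH := IH isT; set J : R := L.+2%:R in IH *.
have J0 : 0 < J by rewrite ltr0n.
have JE : L.+1%:R = J - 1 by rewrite /J -[_.+2%:R]natr1 addrK.
have J1 : 0 < J - 1 by rewrite -JE ltr0n.
clearbody J.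
have : ln (1 + - J^-1) <= - J^-1.
  rewrite le_ln1Dx// ltrN2 invf_lt1//; lra.
have -> : 1 + - J^-1 = (J - 1) / J by field; rewrite gt_eqF.
rewrite ln_div ?posrE// => i1; rewrite JE in IH; lra.
Qed.

Lemma sum_powR_sub2_le b L : b < 1 -> \sum_(0 <= j < L) j.+1%:R `^ (b - 2) <= 1 + (1 - b)^-1.
Proof.
move=> b1; have c0 : 0 < 1 - b by rewrite subr_gt0.
have ci0 : 0 < (1 - b)^-1 by rewrite invr_gt0.
(* The terms after the first one are dominated by the increments of
   [- x `^ (b - 1) / (1 - b)]. *)
suff : (0 < L)%N -> \sum_(0 <= j < L) j.+1%:R `^ (b - 2) <=
    1 + (1 - L%:R `^ (b - 1)) / (1 - b).
  case: L => [_|L /(_ isT)]; first by rewrite big_geq// addr_ge0// (ltW ci0).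
  move/le_trans; apply; rewrite lerD2l -[leRHS]mul1r; apply: ler_wpM2r; first exact: ltW.
  by have := powR_ge0 (L.+1%:R : R) (b - 1); lra.
elim: L => // -[|L] IH _; first by rewrite big_nat1 !powR1 subrr mul0r addr0.
rewrite big_nat_recr//=; have {}IH := IH isT; set J : R := L.+2%:R in IH *.
have J0 : 0 < J by rewrite ltr0n.
have JE : L.+1%:R = J - 1 by rewrite /J -[_.+2%:R]natr1 addrK.
have J1 : 0 < J - 1 by rewrite -JE ltr0n.
clearbody J.
pose y := (J - 1) / J; have y0 : 0 < y by rewrite divr_gt0.
have ylow : 1 + (1 - b) / J <= y `^ (b - 1).
  have lny : ln y <= - J^-1.
    have -> : y = 1 + - J^-1 by rewrite /y; field; rewrite gt_eqF.
    by rewrite le_ln1Dx// ltrN2 invf_lt1//; lra.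
  rewrite /powR gt_eqF//; apply: le_trans (expR_ge1Dx _).
  by rewrite lerD2l; have := ler_wpM2l (ltW c0) lny; lra.
have Jy : (J - 1) `^ (b - 1) = J `^ (b - 1) * y `^ (b - 1).
  by rewrite -powRM ?(ltW J0) ?(ltW y0)// /y mulrC divfK ?gt_eqF.
have J2 : J `^ (b - 2) = J `^ (b - 1) / J.
  have -> : b - 2 = (b - 1) - 1 by ring.
  by rewrite [LHS]powRB ?(gt_eqF J0) ?implybT// powRr1// ltW.
rewrite JE Jy in IH; rewrite J2.
have P0 : 0 <= J `^ (b - 1) by exact: powR_ge0.
have := ler_wpM2l P0 ylow; set p := J `^ (b - 1) in IH P0 *; set w := y `^ _ in IH * => i2.
apply: (le_trans (lerD IH (lexx _))).
have -> : 1 + (1 - p) / (1 - b) = (1 + (1 - p * w) / (1 - b)) + (p * w - p) / (1 - b).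
  by field; rewrite gt_eqF.
rewrite lerD2l ler_pdivlMr//.
have -> : p / J * (1 - b) = p * ((1 - b) / J) by ring.
by lra.
Qed.

(** The pairs [(i, j)] with [i + j < L] are part of a square. *)
Lemma sum_convolution_le (x z : nat -> R) L :
  (forall i, 0 <= x i) -> (forall i, 0 <= z i) ->
  \sum_(0 <= N < L.+1) \sum_(0 <= i < N) x i * z (N - i.+1)%N <=
  (\sum_(0 <= i < L) x i) * (\sum_(0 <= j < L) z j).
Proof.
move=> x0 z0.
have -> : \sum_(0 <= N < L.+1) \sum_(0 <= i < N) x i * z (N - i.+1)%N =
    \sum_(0 <= i < L) x i * \sum_(0 <= j < (L - i)%N) z j.
  elim: L => [|L IH]; first by rewrite big_nat1 !big_geq.
  rewrite big_nat_recr//= IH [RHS]big_nat_recr//= subSnn big_nat1.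
  rewrite [X in _ + X]big_nat_recr//= subnn addrA; congr (_ + _).
  rewrite -big_split/= big_nat [RHS]big_nat; apply: eq_bigr => i /andP[_ iL].
  by rewrite -mulrDr subSS subSn ?(ltnW iL)// big_nat_recr.
rewrite mulr_suml; apply: ler_sum => i _; apply: ler_wpM2l => //.
rewrite [leRHS](big_cat_nat (n := (L - i)%N)) ?leq_subr//= lerDl.
by apply: sumr_ge0 => j _; exact: z0.
Qed.

End sums_of_powers.

Section variance_factor.
Context {R : realType}.
Implicit Types (b : R) (n N L : nat).

(** Bound, up to a constant factor, for twice the expected product of the
    increments in the grid cells [i + 1] and [i + j + 3], which are separated by
    [j + 1] cells. *)
Definition correlation_weight b i j : R :=
  i.+1%:R^-1 * j.+1%:R `^ (b - 1) + j.+1%:R `^ (b - 2).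

(** Bound, up to a constant factor, for the second moment of the sum of the
    increments in the cells [1, ..., N]. Each cell after the first contributes
    [3]: its own second moment, and the product with the adjacent cell, bounded
    by two further second moments. The products with the other cells contribute
    the [correlation_weight]s. *)
Definition variance_factor b N : R :=
  if N is N'.+1 then 1 + 3 * N'%:R +
    \sum_(0 <= L < N') \sum_(0 <= i < L) correlation_weight b i (L - i.+1)
  else 0.

Lemma variance_factorS b N : variance_factor b N.+2 =
  variance_factor b N.+1 + 3 +
  \sum_(0 <= i < N) correlation_weight b i (N - i.+1).
Proof. by rewrite /variance_factor big_nat_recr//= -natr1; ring. Qed.

Lemma sum_correlation_weight_le b N :
  \sum_(0 <= L < N) \sum_(0 <= i < L) correlation_weight b i (L - i.+1) <=
  (\sum_(0 <= i < N) i.+1%:R^-1) * (\sum_(0 <= j < N) j.+1%:R `^ (b - 1)) +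
  N%:R * \sum_(0 <= j < N) j.+1%:R `^ (b - 2).
Proof.
case: N => [|N]; first by rewrite !big_geq// mulr0 mul0r addr0.
pose z (j : nat) := j.+1%:R `^ (b - 2) : R.
pose y (j : nat) := j.+1%:R `^ (b - 1) : R.
pose x (i : nat) := i.+1%:R^-1 : R.
have x0 i : 0 <= x i by rewrite invr_ge0.
have y0 i : 0 <= y i by exact: powR_ge0.
have z0 i : 0 <= z i by exact: powR_ge0.
have mono (u : nat -> R) (m k : nat) : (forall i, 0 <= u i) -> (m <= k)%N ->
    \sum_(0 <= i < m) u i <= \sum_(0 <= i < k) u i.
  move=> u0 mk; rewrite [leRHS](big_cat_nat (n := m))//= lerDl.
  by apply: sumr_ge0 => i _; exact: u0.
rewrite /correlation_weight; under eq_bigr do rewrite big_split/=.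
rewrite big_split/=; apply: lerD.
  apply: le_trans (sum_convolution_le N x0 y0) _.
  by apply: ler_pM; rewrite ?sumr_ge0//; apply: mono.
rewrite -[N.+1 in leRHS]subn0 mulr_natl -sumr_const_nat; apply: ler_sum_nat => L /andP[_ LN].
rewrite subn0; apply: le_trans (mono z _ _ z0 (ltnW LN)).
rewrite [leRHS]big_nat_rev/= add0n le_eqVlt; apply/orP; left; apply/eqP.
by apply: eq_bigr.
Qed.

Lemma ln_ge n : (0 < n)%N -> 2 * (1 - (Num.sqrt n%:R)^-1) <= ln n%:R :> R.
Proof.
move=> n0; set s := Num.sqrt n%:R.
have s0 : 0 < s by rewrite sqrtr_gt0 ltr0n.
have -> : n%:R = s ^+ 2 by rewrite sqr_sqrtr.
have : ln s^-1 <= s^-1 - 1.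
  by rewrite -{1}(subrK 1 s^-1) addrC le_ln1Dx// ltrBrDl subrr invr_gt0.
rewrite lnV ?posrE// -mulr_natl.
by rewrite lnXn// -mulr_natl; lra.
Qed.

Lemma variance_factor_lt1 b n : 0 < b < 1 -> (0 < n)%N ->
  3 + 3 / 2 * variance_factor b n.-1 <= 8 * ((1 - b)^-1 * b^-1) * n%:R.
Proof.
move=> /andP[b0 b1] n0; set K := (1 - b)^-1 * b^-1.
have c0 : 0 < 1 - b by rewrite subr_gt0.
have K0 : 0 < K by rewrite mulr_gt0 ?invr_gt0.
have Kbc : K * (b * (1 - b)) = 1.
  by rewrite /K; field; rewrite !gt_eqF.
have K4 : 4 <= K by have := mulr_ge0 (ltW K0) (sqr_ge0 (1 - 2 * b)); nra.
have Kb : b^-1 + (1 - b)^-1 = K by rewrite /K; field; rewrite !gt_eqF.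
have bi0 : 0 < b^-1 by rewrite invr_gt0.
have ci0 : 0 < (1 - b)^-1 by rewrite invr_gt0.
case: n n0 => // -[_|[_|N _]] /=; first by rewrite mulr0; lra.
  by rewrite big_geq// mulr0; lra.
have := sum_correlation_weight_le b N.+1.
have bP : 0 < b <= 1 by rewrite b0 ltW.
have := sum_powR_le N.+1 bP; have := sum_powR_sub2_le N.+1 b1.
have := @sum_inv_le R N.+1 isT.
set X := \sum_(0 <= i < N.+1) i.+1%:R^-1.
set Y := \sum_(0 <= j < N.+1) _ `^ (b - 1); set Z := \sum_(0 <= j < N.+1) _ `^ (b - 2).
set S := \sum_(0 <= L < N.+1) _ => iX iZ iY iS.
set J : R := N.+1%:R in iX iY iS *.
have J1 : 1 <= J by rewrite ler1n.
have J0 : 0 < J by rewrite (lt_le_trans ltr01).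
have -> : N.+3%:R = J + 2 :> R by rewrite /J -addn2 natrD.
have Y0 : 0 <= Y by apply: sumr_ge0 => j _; exact: powR_ge0.
have pb0 : 0 < J `^ b by rewrite powR_gt0.
(* [ln w <= w - 1] at [w = J^(1 - b)] lets the power absorb the logarithm. *)
have lnJ : ln J * (1 - b) <= J `^ (1 - b) - 1.
  rewrite mulrC -ln_powR; set w := J `^ (1 - b).
  have w0 : 0 < w by rewrite powR_gt0.
  by rewrite -{1}(subrK 1 w) addrC le_ln1Dx// ltrBrDl subrr.
have JJ : J `^ b * J `^ (1 - b) = J.
  by rewrite -powRD ?(gt_eqF J0) ?implybT// addrC subrK powRr1// ltW.
have XY : X * Y <= J * K.
  have l0 : 0 <= ln J by rewrite ln_ge0.
  apply: (@le_trans _ _ ((1 + ln J) * (J `^ b / b))).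
    apply: ler_pM => //; apply: sumr_ge0 => i _; by rewrite invr_ge0.
  rewrite [_ * (_ / _)](_ : _ = (1 - b + ln J * (1 - b)) * (J `^ b) * K); last first.
    by rewrite /K; field; rewrite !gt_eqF.
  rewrite ler_wpM2r ?(ltW K0)//.
  have := ler_wpM2l (ltW pb0) lnJ.
  rewrite [_ * (_ `^ _ - 1)]mulrBr JJ; nra.
have JZ : J * Z <= J * (1 + (1 - b)^-1) by rewrite ler_wpM2l// ltW.
have JcK : J * (1 - b)^-1 <= J * K by rewrite ler_wpM2l ?(ltW J0)// -Kb; lra.
have JK4 : 4 * J <= J * K by rewrite mulrC ler_wpM2l// ltW.
lra.
Qed.

Lemma variance_factor_eq1 n : (2 <= n)%N ->
  3 + 3 / 2 * variance_factor 1 n.-1 <= 8 * n%:R * ln n%:R :> R.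
Proof.
case: n => // -[|N] // _ /=.
have := sum_correlation_weight_le 1 N.
have L0 := @ln_ge N.+2 isT.
have iX : \sum_(0 <= i < N) i.+1%:R^-1 <= 1 + ln N.+2%:R :> R.
  case: N L0 => [|N] _; first by rewrite big_geq// addr_ge0// ln_ge0// ler1n.
  apply: le_trans (@sum_inv_le R N.+1 isT) _; rewrite lerD2l.
  by rewrite ler_ln ?posrE ?ltr0n// ler_nat; do 2 apply: leqW.
set X := \sum_(0 <= i < N) i.+1%:R^-1 in iX *.
have -> : \sum_(0 <= j < N) j.+1%:R `^ (1 - 1) = N%:R :> R.
  under eq_bigr do rewrite subrr powRr0.
  by rewrite sumr_const_nat subn0.
have -> : \sum_(0 <= j < N) j.+1%:R `^ (1 - 2) = X :> R.
  by apply: eq_bigr => j _; rewrite (_ : 1 - 2 = -1) ?powR_inv1//; ring.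
set S := \sum_(0 <= L < N) _ => iS.
set s := Num.sqrt N.+2%:R in L0.
have s2 : s ^+ 2 = N.+2%:R by rewrite sqr_sqrtr.
have NE : N%:R = s ^+ 2 - 2 by rewrite s2 -addn2 natrD addrK.
have N0 : 0 <= N%:R :> R by [].
have s1 : 1 <= s by rewrite -sqrtr1 ler_sqrt// ler1n.
have s0 : 0 < s by lra.
set l := ln _ in L0 iX *.
have NX : N%:R * X <= N%:R * (1 + l) by rewrite ler_wpM2l.
apply: (@le_trans _ _ (9 / 2 + 15 / 2 * N%:R + 3 * N%:R * l)); first by nra.
rewrite -s2 NE -subr_ge0.
have L1 : (5 * s ^+ 2 + 6) * (2 * (1 - s^-1)) <= (5 * s ^+ 2 + 6) * l.
  by rewrite ler_wpM2l// addr_ge0// mulr_ge0// sqr_ge0.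
(* After [ln n >= 2 (1 - 1 / s)], a polynomial inequality in [s = sqrt n >= 1]
   remains. *)
have : 0 <= (5 * s ^+ 2 + 6) * (2 * (1 - s^-1)) - (15 / 2 * s ^+ 2 - 21 / 2).
  rewrite [X in 0 <= X](_ : _ = (5 / 2 * s * (s - 2) ^+ 2 + (25 / 2 * s - 12)) / s).
    apply: divr_ge0; last exact: ltW.
    by apply: addr_ge0; [rewrite mulr_ge0 ?sqr_ge0// mulr_ge0// ltW|lra].
  by field; rewrite gt_eqF.
nra.
Qed.

End variance_factor.

(** * The second moment of a sum of increments *)

Section second_moment_sum.
Context {R : realType} {dO : measure_display} {Omega : measurableType dO}.
Variables (P : probability Omega R) (Y : R -> Omega -> R) (n : nat) (b w tau : R).
Variable s : nat -> R.
Hypotheses (mY : forall t, measurable_fun setT (Y t)) (w0 : 0 <= w).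
Let V u v := (\int[P]_x ((Y v x - Y u x) ^+ 2)%:E)%E.
Hypothesis Vdiag : forall k, (k < n)%N -> (V (s k) (s k + tau) <= w%:E)%E.
Hypothesis Vcross : forall i j l, l = (i + j + 3)%N -> (l < n)%N ->
  (V (s i.+1) (s l + tau) + V (s i.+1 + tau) (s l) <=
   V (s i.+1) (s l) + V (s i.+1 + tau) (s l + tau) +
   (w * correlation_weight b i j)%:E)%E.
Hypothesis Vfin : forall i l, (i.+1 < l < n)%N ->
  (V (s i.+1) (s l) < +oo)%E /\ (V (s i.+1 + tau) (s l + tau) < +oo)%E.

Let a k x := Y (s k + tau) x - Y (s k) x.
Let A N x := \sum_(0 <= i < N) a i.+1 x.

Let ma k : measurable_fun setT (a k).
Proof. exact: measurable_funB. Qed.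

Let mA N : measurable_fun setT (A N).
Proof. by apply: measurable_sum => i; exact: ma. Qed.

Let msqr (f : Omega -> R) : measurable_fun setT f ->
  measurable_fun setT (fun x => (f x ^+ 2)%:E).
Proof. by move=> mf; apply/measurable_EFinP; exact: measurable_funX. Qed.

Let mV u v : measurable_fun setT (fun x => ((Y v x - Y u x) ^+ 2)%:E).
Proof. by apply: msqr; exact: measurable_funB. Qed.

Let sqrE0 (f : Omega -> R) x : (0 <= (f x ^+ 2)%:E)%E.
Proof. by rewrite lee_fin sqr_ge0. Qed.

Local Open Scope ereal_scope.

Let neg i l x : R := ((Y (s l) x - Y (s i) x) ^+ 2 +
  (Y (s l + tau) x - Y (s i + tau) x) ^+ 2)%R.
Let pos i l x : R := ((Y (s l + tau) x - Y (s i) x) ^+ 2 +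
  (Y (s l) x - Y (s i + tau) x) ^+ 2)%R.

Let mneg i l : measurable_fun setT (fun x => (neg i l x)%:E).
Proof.
by apply/measurable_EFinP; apply: measurable_funD; apply: measurable_funX;
  exact: measurable_funB.
Qed.

Let mpos i l : measurable_fun setT (fun x => (pos i l x)%:E).
Proof.
by apply/measurable_EFinP; apply: measurable_funD; apply: measurable_funX;
  exact: measurable_funB.
Qed.

Let neg0 i l x : (0 <= (neg i l x)%:E).
Proof. by rewrite lee_fin addr_ge0// sqr_ge0. Qed.
Let pos0 i l x : (0 <= (pos i l x)%:E).
Proof. by rewrite lee_fin addr_ge0// sqr_ge0. Qed.

Let int_neg i l : \int[P]_x (neg i l x)%:E = V (s i) (s l) + V (s i + tau) (s l + tau).
Proof.
transitivity (\int[P]_x (((Y (s l)%R x - Y (s i)%R x) ^+ 2)%:E +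
    ((Y (s l + tau)%R x - Y (s i + tau)%R x) ^+ 2)%:E)).
  by apply: eq_integral => x _; rewrite EFinD.
by rewrite ge0_integralD//; do ?[exact: mV|move=> x _; rewrite lee_fin sqr_ge0].
Qed.

Let int_pos i l : \int[P]_x (pos i l x)%:E = V (s i) (s l + tau) + V (s i + tau) (s l).
Proof.
transitivity (\int[P]_x (((Y (s l + tau)%R x - Y (s i)%R x) ^+ 2)%:E +
    ((Y (s l)%R x - Y (s i + tau)%R x) ^+ 2)%:E)).
  by apply: eq_integral => x _; rewrite EFinD.
by rewrite ge0_integralD//; do ?[exact: mV|move=> x _; rewrite lee_fin sqr_ge0].
Qed.

(* [2 a_i a_l = pos i l - neg i l], and the adjacent pair is bounded by
   [2 a_k a_l <= a_k^2 + a_l^2]. *)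
Let pointwise_step N x : (A N.+2 x ^+ 2 + \sum_(0 <= i < N) neg i.+1 N.+2 x <=
  A N.+1 x ^+ 2 + a N.+1 x ^+ 2 + 2 * a N.+2 x ^+ 2 +
    \sum_(0 <= i < N) pos i.+1 N.+2 x)%R.
Proof.
have far : (\sum_(0 <= i < N) pos i.+1 N.+2 x =
    \sum_(0 <= i < N) neg i.+1 N.+2 x + 2 * (\sum_(0 <= i < N) a i.+1 x) * a N.+2 x)%R.
  rewrite -mulrA mulr_suml mulr_sumr -big_split/=; apply: eq_bigr => i _.
  by rewrite /pos /neg /a; ring.
rewrite far {1}/A big_nat_recr//= -/(A N.+1 x).
have -> : (\sum_(0 <= i < N) a i.+1 x = A N.+1 x - a N.+1 x)%R.
  by rewrite /A big_nat_recr//= addrK.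
have := sqr_ge0 (a N.+1 x - a N.+2 x)%R; nra.
Qed.

Let moment_step N : (N.+2 < n)%N ->
  \int[P]_x (A N.+2 x ^+ 2)%:E <= \int[P]_x (A N.+1 x ^+ 2)%:E +
    (w * (3 + \sum_(0 <= i < N) correlation_weight b i (N - i.+1)))%:E.
Proof.
move=> Nn.
pose negs x := \sum_(0 <= i < N) (neg i.+1 N.+2 x)%:E.
pose poss x := \sum_(0 <= i < N) (pos i.+1 N.+2 x)%:E.
have mnegs : measurable_fun setT negs by apply: emeasurable_sum => i; exact: mneg.
have mposs : measurable_fun setT poss by apply: emeasurable_sum => i; exact: mpos.
have negs0 x : 0 <= negs x by apply: sume_ge0.
have poss0 x : 0 <= poss x by apply: sume_ge0.
have int_negs : \int[P]_x negs x =
    \sum_(0 <= i < N) (V (s i.+1) (s N.+2) + V (s i.+1 + tau) (s N.+2 + tau)).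
  rewrite ge0_integral_sum//.
  by apply: eq_bigr => i _; rewrite int_neg.
have int_poss : \int[P]_x poss x =
    \sum_(0 <= i < N) (V (s i.+1) (s N.+2 + tau) + V (s i.+1 + tau) (s N.+2)).
  rewrite ge0_integral_sum//.
  by apply: eq_bigr => i _; rewrite int_pos.
have idx i : (i < N)%N -> (N.+2 = i + (N - i.+1) + 3)%N by move=> iN; lia.
have poss_le : \int[P]_x poss x <= \int[P]_x negs x +
    (w * \sum_(0 <= i < N) correlation_weight b i (N - i.+1))%:E.
  rewrite int_poss int_negs mulr_sumr -sumEFin -big_split/=.
  rewrite big_nat [leRHS]big_nat; apply: lee_sum => i /andP[_ iN].
  by apply: Vcross => //; exact: idx.
have negs_fin : \int[P]_x negs x \is a fin_num.
  rewrite ge0_fin_numE; last exact: integral_ge0.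
  rewrite int_negs big_nat; apply: lte_sum_pinfty => i /andP[_ iN].
  have [|h1 h2] := @Vfin i N.+2; first by rewrite Nn andbT !ltnS ltnW.
  exact: lte_add_pinfty.
rewrite -(leeD2rE _ _ negs_fin).
apply: (@le_trans _ _ (\int[P]_x ((A N.+1 x ^+ 2)%:E + ((a N.+1 x ^+ 2)%:E +
    2%:E * (a N.+2 x ^+ 2)%:E) + poss x))).
  rewrite -ge0_integralD//; last exact: msqr.
  apply: ge0_le_integral => //.
  - by move=> x _; rewrite adde_ge0// lee_fin sqr_ge0.
  - by apply: emeasurable_funD => //; exact: msqr.
  - apply: emeasurable_funD => //; apply: emeasurable_funD; first exact: msqr.
    by apply: emeasurable_funD; [|apply: emeasurable_funM => //]; exact: msqr.
  - move=> x _; rewrite /negs /poss !sumEFin -!EFinM -!EFinD lee_fin.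
    by have := pointwise_step N x; lra.
have aE k : (k < n)%N -> \int[P]_x (a k x ^+ 2)%:E <= w%:E by exact: Vdiag.
have ma2 k : measurable_fun setT (fun x => 2%:E * (a k x ^+ 2)%:E).
  by apply: emeasurable_funM => //; exact: msqr.
have a20 k x : 0 <= 2%:E * (a k x ^+ 2)%:E by rewrite mule_ge0// lee_fin.
have ma3 k l : measurable_fun setT (fun x => (a k x ^+ 2)%:E + 2%:E * (a l x ^+ 2)%:E).
  by apply: emeasurable_funD => //; exact: msqr.
have a30 k l x : 0 <= (a k x ^+ 2)%:E + 2%:E * (a l x ^+ 2)%:E.
  by rewrite adde_ge0.
have mA2 k : measurable_fun setT (fun x => (A k x ^+ 2)%:E) by exact: msqr.
have ma1 k : measurable_fun setT (fun x => (a k x ^+ 2)%:E) by exact: msqr.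
rewrite ge0_integralD//; try by [exact: emeasurable_funD|move=> x _; rewrite adde_ge0].
rewrite ge0_integralD// ge0_integralD// ge0_integralZl_EFin//.
have arith (x0 x1 x2 px nx : \bar R) (c : R) : x1 <= w%:E -> x2 <= w%:E ->
    px <= nx + (w * c)%:E -> x0 + (x1 + 2%:E * x2) + px <= x0 + (w * (3 + c))%:E + nx.
  move=> x1w x2w pn; rewrite -!addeA leeD2l//.
  have -> : (w * (3 + c))%:E + nx = (w%:E + 2%:E * w%:E) + (nx + (w * c)%:E).
    by rewrite [nx + _]addeC addeA -EFinM -!EFinD; congr (_%:E + _); ring.
  rewrite addeA; apply: leeD => //; apply: leeD => //.
  by apply: lee_wpmul2l; rewrite ?lee_fin.
by apply: arith => //; apply: aE; [exact: ltnW|].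
Qed.

Let moment_le N : (N < n)%N ->
  \int[P]_x (A N x ^+ 2)%:E <= (w * variance_factor b N)%:E.
Proof.
elim: N => [|[|N] IH] Nn.
- rewrite mulr0 integral0_eq// => x _.
  by rewrite /A big_geq// expr0n.
- rewrite /= mulr0 addr0 big_geq// addr0 mulr1; apply: le_trans (Vdiag Nn).
  rewrite le_eqVlt; apply/orP; left; apply/eqP.
  by apply: eq_integral => x _; rewrite /A big_nat1.
- apply: le_trans (moment_step Nn) _.
  rewrite variance_factorS.
  move: (\sum_(0 <= i < N) correlation_weight b i (N - i.+1))%R => S.
  have -> : (w * (variance_factor b N.+1 + 3 + S))%:E =
      (w * variance_factor b N.+1)%:E + (w * (3 + S))%:E.
    by rewrite -EFinD; congr EFin; ring.
  apply: leeD => //.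
  by apply: IH; exact: ltnW.
Qed.

(** The bounds on products of increments blow up as the start of the first one
    tends to time [0], so the cell [0] is split off by
    [(u + v)^2 <= 3 u^2 + 3/2 v^2]. *)
Lemma second_moment_sum_le : (0 < n)%N ->
  \int[P]_x ((\sum_(0 <= k < n) (Y (s k + tau) x - Y (s k) x)) ^+ 2)%:E <=
  (w * (3 + 3 / 2 * variance_factor b n.-1))%:E.
Proof.
case: n Vdiag moment_le => // n' Vd ml _.
apply: (@le_trans _ _ (\int[P]_x (3%:E * (a 0 x ^+ 2)%:E +
    (3 / 2)%:E * (A n' x ^+ 2)%:E))).
  apply: ge0_le_integral => //.
  - by move=> x _; rewrite lee_fin sqr_ge0.
  - by apply: msqr; apply: measurable_sum => k; exact: ma.
  - by apply: emeasurable_funD; apply: emeasurable_funM => //; exact: msqr.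
  - move=> x _; rewrite big_nat_recl//= -/(a 0 x) -/(A n' x) -!EFinM -EFinD lee_fin.
    by have := sqr_ge0 (2 * a 0 x - A n' x)%R; nra.
have mc (c : R) (f : Omega -> R) : measurable_fun setT f ->
    measurable_fun setT (fun x => c%:E * (f x ^+ 2)%:E).
  by move=> mf; apply: emeasurable_funM => //; exact: msqr.
rewrite ge0_integralD//; try by [exact: mc|move=> x _; rewrite mule_ge0// lee_fin].
rewrite !ge0_integralZl_EFin//; try exact: msqr.
have -> : (w * (3 + 3 / 2 * variance_factor b n'))%:E =
    3%:E * w%:E + (3 / 2)%:E * (w * variance_factor b n')%:E.
  by rewrite -!EFinM -EFinD; congr EFin; ring.
apply: leeD; apply: lee_wpmul2l; rewrite ?lee_fin//; first exact: Vd.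
exact: ml.
Qed.

End second_moment_sum.

(** * The error of the integral sums along a path *)

Section path_error.
Context {R : realType}.
Local Notation mu := (@lebesgue_measure R).
Implicit Types (g : R -> R) (a b t delta : R).

Lemma Rintegral_itv_shift a b t g : measurable_fun setT g ->
  \int[mu]_(u in `[a + t, b + t]) g u = \int[mu]_(u in `[a, b]) g (u + t).
Proof.
move=> mg; have mgE : measurable_fun setT (EFin \o g) by exact/measurable_EFinP.
rewrite /Rintegral; congr fine; rewrite integralE [RHS]integralE; congr (_ - _)%E.
- rewrite (integral_itv_shift a b t (measurable_funepos mgE)) => [|u].
    by apply: eq_integral => u _; rewrite !funeposE.
  exact: funepos_ge0.
- rewrite (integral_itv_shift a b t (measurable_funeneg mgE)) => [|u].
    by apply: eq_integral => u _; rewrite !funenegE.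
  exact: funeneg_ge0.
Qed.

Lemma integrable_itv_shift a b t g : measurable_fun setT g ->
  mu.-integrable `[a + t, b + t] (EFin \o g) ->
  mu.-integrable `[a, b] (fun u => (g (u + t))%:E).
Proof.
move=> mg /integrableP[_ goo].
have mgt : measurable_fun setT (fun u : R => g (u + t)).
  by apply: measurableT_comp => //; exact: measurable_funD.
apply/integrableP; split.
  by apply/measurable_EFinP; exact: measurable_funTS.
apply: le_lt_trans goo; rewrite (integral_itv_shift a b t (f := fun u => `|(g u)%:E|%E))//.
by apply: measurableT_comp => //; exact/measurable_EFinP.
Qed.

Let integrable_itv_cst a b c : mu.-integrable `[a, b] (fun=> c%:E).
Proof.
apply/integrableP; split; first exact: measurable_cst.
rewrite integral_cst//= lebesgue_measure_itv/=.
by case: ifP => _; rewrite ?mule0 ?ltry// -EFinB -EFinM ltry.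
Qed.

(** Jensen's inequality on an interval. *)
Lemma sqr_Rintegral_le delta g : 0 < delta -> measurable_fun setT g ->
  mu.-integrable `[0, delta] (EFin \o g) ->
  (((\int[mu]_(u in `[0, delta]) g u) ^+ 2)%:E <=
   delta%:E * \int[mu]_(u in `[0%R, delta]) (g u ^+ 2)%:E)%E.
Proof.
move=> delta0 mg ig; set I := \int[mu]_(u in _) g u.
have mg2 : measurable_fun `[0, delta]%classic (fun u => (g u ^+ 2)%:E).
  by apply/measurable_EFinP; apply: measurable_funX; exact: measurable_funTS.
have leb0 : mu `[0, delta]%classic = delta%:E.
  by rewrite lebesgue_measure_itv/= lte_fin delta0 sube0.
have [g2oo|] := ltP (\int[mu]_(u in `[0%R, delta]) (g u ^+ 2)%:E)%E +oo%E; last first.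
  by rewrite leye_eq => /eqP ->; rewrite gt0_muley ?lte_fin// leey.
have ig2 : mu.-integrable `[0, delta] (fun u => (g u ^+ 2)%:E).
  apply/integrableP; split => //; apply: le_lt_trans g2oo.
  by rewrite le_eqVlt; apply/orP; left; apply/eqP; apply: eq_integral => u _;
    rewrite gee0_abs// lee_fin sqr_ge0.
pose c := I / delta.
have mi : measurable (`[0, delta]%classic : set (measurableTypeR R)) by [].
have ic : mu.-integrable `[0, delta] (fun=> (c ^+ 2)%:E).
  exact: integrable_itv_cst.
have icg : mu.-integrable `[0, delta] (fun u => ((2 * c)%:E * (g u)%:E)%E).
  exact: integrableZl.
(* The inequality [2 c g - c^2 <= g^2] at the mean value [c] of [g]. *)
have := @le_integral _ _ _ mu _ mi _ _ (integrableB mi icg ic) ig2.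
have -> : (\int[mu]_(u in `[0%R, delta]) ((2 * c)%:E * (g u)%:E - (c ^+ 2)%:E) =
    (2 * c * I - c ^+ 2 * delta)%:E)%E.
  have IE : (\int[mu]_(u in `[0%R, delta]) (g u)%:E = I%:E)%E.
    by rewrite /I /Rintegral fineK//; exact: integrable_fin_num.
  by rewrite integralB// integralZl// integral_cst//= leb0 IE -!EFinM.
move=> h; have {}h : ((2 * c * I - c ^+ 2 * delta)%:E <=
    \int[mu]_(u in `[0%R, delta]) (g u ^+ 2)%:E)%E.
  by apply: h => u _; rewrite -EFinM -EFinB lee_fin; have := sqr_ge0 (g u - c); nra.
have -> : (I ^+ 2)%:E = (delta%:E * (2 * c * I - c ^+ 2 * delta)%:E)%E.
  by rewrite -EFinM; congr EFin; rewrite /c; field; rewrite gt_eqF.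
by apply: lee_wpmul2l; rewrite ?lee_fin// ltW.
Qed.

(** All the grid cells are translated to the common interval [[0, delta]]. *)
Lemma path_error_eq delta g m : 0 < delta -> measurable_fun setT g ->
  mu.-integrable `[0, m%:R * delta] (EFin \o g) ->
  mu.-integrable `[0, delta]
    (fun t => (\sum_(0 <= k < m) (g (k%:R * delta + t) - g (k%:R * delta)))%:E) /\
  \int[mu]_(t in `[0, m%:R * delta]) g t - delta * \sum_(0 <= k < m) g (k%:R * delta) =
  \int[mu]_(t in `[0, delta]) \sum_(0 <= k < m) (g (k%:R * delta + t) - g (k%:R * delta)).
Proof.
move=> delta0 mg; have leb0 : mu `[0, delta]%classic = delta%:E.
  by rewrite lebesgue_measure_itv/= lte_fin delta0 sube0.
elim: m => [|m IH] ig.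
  have S0 t : \sum_(0 <= k < 0) (g (k%:R * delta + t) - g (k%:R * delta)) = 0.
    by rewrite big_geq.
  split.
    have -> : (fun t => (\sum_(0 <= k < 0) (g (k%:R * delta + t) - g (k%:R * delta)))%:E) =
        fun=> 0%:E by apply/funext => t; rewrite S0.
    exact: integrable_itv_cst.
  rewrite big_geq// mulr0 subr0 mul0r set_itv1 Rintegral_set1.
  under eq_Rintegral do rewrite S0.
  by rewrite Rintegral_cst// mul0r.
have md0 : 0 <= m%:R * delta by rewrite mulr_ge0// ltW.
have mS : m.+1%:R * delta = m%:R * delta + delta by rewrite -natr1 mulrDl mul1r.
have mle : m%:R * delta <= m.+1%:R * delta by rewrite mS; lra.
have [|iS E] := IH.
  apply: (integrableS _ _ _ ig) => // u /=; rewrite !in_itv/= => /andP[-> um].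
  exact: le_trans um mle.
have mi : measurable (`[0, delta]%classic : set (measurableTypeR R)) by [].
have igm : mu.-integrable `[0, delta] (fun u => (g (m%:R * delta + u))%:E).
  have -> : (fun u => (g (m%:R * delta + u))%:E) = (fun u => (g (u + m%:R * delta))%:E).
    by apply/funext => u; rewrite addrC.
  apply: integrable_itv_shift => //; rewrite add0r addrC -mS.
  apply: (integrableS _ _ _ ig) => // u /=; rewrite !in_itv/= => /andP[um ->].
  by rewrite (le_trans md0 um).
have ic : mu.-integrable `[0, delta] (fun=> (g (m%:R * delta))%:E).
  exact: integrable_itv_cst.
have igc : mu.-integrable `[0, delta]
    (fun u => (g (m%:R * delta + u) - g (m%:R * delta))%:E).
  exact: (integrableB mi igm ic).
split.
  have -> : (fun t => (\sum_(0 <= k < m.+1) (g (k%:R * delta + t) - g (k%:R * delta)))%:E) =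
      (fun t => (\sum_(0 <= k < m) (g (k%:R * delta + t) - g (k%:R * delta)))%:E +
        (g (m%:R * delta + t) - g (m%:R * delta))%:E)%E.
    by apply/funext => t; rewrite big_nat_recr//= EFinD.
  exact: (integrableD mi iS igc).
under [RHS]eq_Rintegral do rewrite big_nat_recr//=.
have cE : \int[mu]_(u in `[0, delta]) g (m%:R * delta) = g (m%:R * delta) * delta.
  by rewrite Rintegral_cst//= leb0.
rewrite RintegralD// -E RintegralB// cE.
have := @Rintegral_itvB R g (BLeft 0) (BRight (m.+1%:R * delta)) (m%:R * delta) ig.
rewrite !bnd_simp => /(_ md0 mle).
rewrite Rintegral_itv_obnd_cbnd; last first.
  apply: (integrableS _ _ _ ig) => // u /=; rewrite !in_itv/= => /andP[um ->].
  by rewrite (le_trans md0 (ltW um)).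
have -> : \int[mu]_(x in `[(m%:R * delta)%R, (m.+1%:R * delta)%R]) g x =
    \int[mu]_(u in `[0, delta]) g (m%:R * delta + u).
  rewrite mS -{1}[m%:R * delta]add0r [_ + delta]addrC Rintegral_itv_shift//.
  by apply: eq_Rintegral => u _; rewrite addrC.
rewrite big_nat_recr//= => <-; ring.
Qed.

End path_error.

(** * The mean square error *)

Section mean_square_error.
Context {R : realType} {d : nat} {dO : measure_display} {Omega : measurableType dO}.
Variables (X : R -> Omega -> 'rV[R]_d) (P : 'rV[R]_d -> probability Omega R).
Variable p : R -> 'rV[R]_d -> 'rV[R]_d -> R.
Variables (T C alpha gamma : R) (Q h : 'rV[R]_d -> R).
Hypotheses (d0 : (0 < d)%N) (mX : markov_process X P) (pX : transition_density X P p).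
Hypothesis dp : forall t x y, 0 < t -> derivable (fun s => p s x y) t 1.
Hypothesis ddp : forall t x y, 0 < t -> derivable (derive1 (fun s => p s x y)) t 1.
Hypotheses (T0 : 0 < T) (C1 : 1 <= C) (alpha0 : 0 < alpha) (densQ : is_density Q).
Hypothesis p0 : forall t x y, 0 < t <= T ->
  p t x y <= C * t `^ (- (d%:R / alpha)) * Q (t `^ (- alpha^-1) *: (x - y)).
Hypothesis p1 : forall t x y, 0 < t <= T ->
  `| derive1 (fun s => p s x y) t | <=
    C * t `^ (- 1 - d%:R / alpha) * Q (t `^ (- alpha^-1) *: (x - y)).
Hypothesis p2 : forall t x y, 0 < t <= T ->
  `| derive1n 2 (fun s => p s x y) t | <=
    C * t `^ (- 2 - d%:R / alpha) * Q (t `^ (- alpha^-1) *: (x - y)).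
Hypotheses (gamma0 : 0 < gamma) (gammaalpha : gamma <= alpha / 2).
Hypothesis momoo : (moment Q (2 * gamma) < +oo)%E.
Hypothesis hoo : (holder_seminorm gamma h < +oo)%E.
Variables (x : 'rV[R]_d) (n : nat).
Hypothesis n0 : (0 < n)%N.
Local Notation mu := (@lebesgue_measure R).
Local Notation M := (fine (moment Q (2 * gamma))).
Local Notation H := (fine (holder_seminorm gamma h)).
Local Notation beta := (2 * gamma / alpha).
Local Notation K := (H ^+ 2 * M).
Local Notation delta := (T / n%:R).
Local Notation W := (C ^+ 2 * K * delta `^ beta).

Let C0 : 0 <= C. Proof. exact: le_trans C1. Qed.
Let mh : measurable_fun setT h. Proof. exact: (measurable_holder gamma0 hoo d0). Qed.
Let delta0 : 0 < delta. Proof. by rewrite divr_gt0// ltr0n. Qed.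
Let beta0 : 0 < beta. Proof. by rewrite divr_gt0// mulr_gt0. Qed.
Let beta1 : beta <= 1.
Proof. by rewrite ler_pdivrMr// mul1r; move: gammaalpha; rewrite ler_pdivlMr// mulrC. Qed.
Let K0 : 0 <= K.
Proof.
rewrite mulr_ge0 ?sqr_ge0// fine_ge0//; apply: integral_ge0 => z _.
by have [_ Q0 _] := densQ; rewrite lee_fin mulr_ge0 ?powR_ge0.
Qed.
Let nd : n%:R * delta = T.
Proof. by rewrite mulrC divfK// pnatr_eq0 -lt0n. Qed.

(** The process is only constrained at nonnegative times; the negative ones are
    sent to [0]. *)
Definition observed (t : R) (w : Omega) : R := h (X (Num.max t 0) w).
Local Notation Y := observed.

Let YE t w : 0 <= t -> Y t w = h (X t w).
Proof. by move=> t0; rewrite /Y max_l. Qed.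

Let mY2 : measurable_fun setT (fun tw : R * Omega => Y tw.1 tw.2).
Proof.
apply: (measurableT_comp mh).
pose pos := [set z : R * Omega | 0 <= z.1].
have mpos : measurable pos.
  rewrite (_ : pos = fst @^-1` `[0, +oo[%classic); last first.
    by apply/seteqP; split => z /=; rewrite in_itv/= andbT.
  by rewrite -[X in measurable X]setTI; apply: measurable_fst.
apply: (@measurable_comp _ _ _ _ _ _ pos (fun z : R * Omega => X z.1 z.2) setT
  (fun tw : R * Omega => (Num.max tw.1 0, tw.2))) => //.
- by move=> _ [tw _ <-]; rewrite /pos/= le_max lexx orbT.
- exact: (markov_joint_measurable mX).
- apply: measurable_fun_pair => //; apply: measurable_maxr => //; exact: measurable_fst.
Qed.

Let mYt t : measurable_fun setT (Y t).
Proof.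
have mp : measurable_fun setT (fun w : Omega => (t, w)) by exact: measurable_fun_pair.
exact: (measurableT_comp mY2 mp).
Qed.

Let mYw w : measurable_fun setT (Y^~ w).
Proof.
have mp : measurable_fun setT (fun t : R => (t, w)) by exact: measurable_fun_pair.
exact: (measurableT_comp mY2 mp).
Qed.

Let V u v := (\int[P x]_w ((Y v w - Y u w) ^+ 2)%:E)%E.

Let V_le u v : 0 <= u < v -> v - u <= T -> (V u v <= (C * K * (v - u) `^ beta)%:E)%E.
Proof.
move=> uv vuT; have /andP[u0 uv'] := uv; have v0 := le_trans u0 (ltW uv').
apply: le_trans (increment_moment_le d0 mX pX C0 alpha0 densQ p0
  gamma0 momoo hoo x uv vuT).
rewrite le_eqVlt; apply/orP; left; apply/eqP.
by apply: eq_integral => w _; rewrite !YE.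
Qed.

Let s (k : nat) : R := k%:R * delta.

Let s_le k : (k <= n)%N -> s k <= T.
Proof. by move=> kn; rewrite /s -[leRHS]nd ler_wpM2r ?ler_nat// ltW. Qed.

Let powR_anti (u v e : R) : 0 < u -> u <= v -> e <= 0 -> v `^ e <= u `^ e.
Proof.
move=> u0 uv e0; have v0 := lt_le_trans u0 uv.
have -> : e = - (- e) by rewrite opprK.
have r0 : 0 <= - e by rewrite oppr_ge0.
move: (- e) r0 => r r0; rewrite !powRN lef_pV2 ?posrE ?powR_gt0//.
by apply: ge0_ler_powR; rewrite ?nnegrE// ltW.
Qed.

Let W0 : 0 <= W. Proof. by rewrite mulr_ge0 ?powR_ge0// mulr_ge0// sqr_ge0. Qed.

Let CK_le : C * K <= C ^+ 2 * K.
Proof. by rewrite ler_wpM2r// expr2 ler_peMr. Qed.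

Let cross_constant_le (i j : nat) (tau a m : R) : 0 < tau <= delta ->
  a = i.+1%:R * delta -> j.+1%:R * delta <= m ->
  C * K * (tau ^+ 2 * m `^ (beta - 2) + C * tau / a * (tau * m `^ (beta - 1))) <=
  W * correlation_weight beta i j.
Proof.
move=> /andP[tau0 taud] -> jm.
have j0 : 0 < j.+1%:R :> R by rewrite ltr0n.
have i0 : 0 < i.+1%:R :> R by rewrite ltr0n.
have jd0 : 0 < j.+1%:R * delta by rewrite mulr_gt0.
have b2 : beta - 2 <= 0 by rewrite subr_le0 (le_trans beta1)// ler1n.
have b1 : beta - 1 <= 0 by rewrite subr_le0.
have cancel (u v w : R) : u != 0 -> u * (w * (v / u)) = v * w by move=> u0; field.
have tau2 : tau ^+ 2 <= delta ^+ 2 by rewrite lerXn2r ?nnegrE ?(ltW tau0) ?(ltW delta0).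
have E2 : delta ^+ 2 * (j.+1%:R * delta) `^ (beta - 2) = delta `^ beta * j.+1%:R `^ (beta - 2).
  rewrite powRM ?(ltW j0) ?(ltW delta0)// [delta `^ (_ - _)]powRB ?(gt_eqF delta0) ?implybT//.
  by rewrite [delta `^ 2]powR_mulrn ?(ltW delta0)// cancel// expf_neq0// gt_eqF.
have E1 : delta ^+ 2 * (j.+1%:R * delta) `^ (beta - 1) =
    delta * (delta `^ beta * j.+1%:R `^ (beta - 1)).
  rewrite powRM ?(ltW j0) ?(ltW delta0)// [delta `^ (_ - _)]powRB ?(gt_eqF delta0) ?implybT//.
  by rewrite powRr1 ?(ltW delta0)// expr2 -mulrA cancel// gt_eqF.
have I2 : tau ^+ 2 * m `^ (beta - 2) <= delta `^ beta * j.+1%:R `^ (beta - 2).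
  by rewrite -E2; apply: ler_pM; rewrite ?sqr_ge0 ?powR_ge0//; exact: powR_anti.
have I1 : tau ^+ 2 * m `^ (beta - 1) <= delta * (delta `^ beta * j.+1%:R `^ (beta - 1)).
  by rewrite -E1; apply: ler_pM; rewrite ?sqr_ge0 ?powR_ge0//; exact: powR_anti.
pose z := delta `^ beta * j.+1%:R `^ (beta - 2).
pose y := delta `^ beta * j.+1%:R `^ (beta - 1).
have z0 : 0 <= z by rewrite mulr_ge0 ?powR_ge0.
have y0 : 0 <= y by rewrite mulr_ge0 ?powR_ge0.
apply: (@le_trans _ _ (C * K * (z + C * (i.+1%:R^-1 * y)))).
  apply: ler_wpM2l; first exact: mulr_ge0.
  apply: lerD => //.
  rewrite [leLHS](_ : _ = C / (i.+1%:R * delta) * (tau ^+ 2 * m `^ (beta - 1))); last first.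
    by ring.
  rewrite [leRHS](_ : _ = C / (i.+1%:R * delta) * (delta * y)); last first.
    have cancel' (c u v w : R) : u != 0 -> v != 0 -> c * (u^-1 * w) = c / (u * v) * (v * w).
      by move=> u0 v0; field; rewrite u0 v0.
    by apply: cancel'; rewrite gt_eqF.
  by apply: ler_wpM2l => //; rewrite divr_ge0// mulr_ge0// ltW.
rewrite [leRHS](_ : _ = C * K * (C * z + C * (i.+1%:R^-1 * y))); last first.
  by rewrite /correlation_weight /z /y; ring.
apply: ler_wpM2l; first exact: mulr_ge0.
by rewrite lerD2r ler_peMl.
Qed.

Local Notation F := (3 + 3 / 2 * variance_factor beta n.-1).
Let S (t : R) w := \sum_(0 <= k < n) (Y (k%:R * delta + t) w - Y (k%:R * delta) w).

Let S_moment (tau : R) : 0 <= tau <= delta ->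
  (\int[P x]_w (S tau w ^+ 2)%:E <= (W * F)%:E)%E.
Proof.
move=> /andP[tau0 taud]; have s0 k : 0 <= s k by rewrite mulr_ge0// ltW.
have [->|tau0'] := eqVneq tau 0.
  rewrite integral0_eq => [|w _]; last first.
    by rewrite /S big1 ?expr0n// => k _; rewrite addr0 subrr.
  rewrite lee_fin mulr_ge0// addr_ge0// mulr_ge0//.
  case: n.-1 => //= N; rewrite addr_ge0 ?addr_ge0 ?mulr_ge0//.
  apply: sumr_ge0 => L _; apply: sumr_ge0 => i _.
  by rewrite addr_ge0 ?mulr_ge0 ?powR_ge0.
have {tau0 tau0'} tau0 : 0 < tau by rewrite lt_neqAle eq_sym tau0'.
have dT : delta <= T by rewrite -[leRHS]nd -[leLHS]mul1r ler_wpM2r ?ler1n// ltW.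
have sE i j k : (i + k)%N = j -> s j = s i + s k.
  by move=> <-; rewrite /s natrD mulrDl.
apply: (@second_moment_sum_le R dO Omega (P x) Y n beta W tau s mYt) => //.
- move=> k kn; apply: le_trans (@V_le (s k) (s k + tau) _ _) _.
  + by rewrite s0/= ltrDl.
  + by rewrite addrAC subrr add0r (le_trans taud).
  rewrite lee_fin addrAC subrr add0r.
  apply: ler_pM; [exact: mulr_ge0 C0 K0|exact: powR_ge0|exact: CK_le|].
  by apply: ge0_ler_powR; rewrite ?nnegrE// ?(ltW beta0) ?(ltW tau0) ?(ltW delta0).
- move=> i j l lE ln; pose k := i.+1; rewrite -/k.
  have sk0 : 0 < s k by rewrite /s mulr_gt0// ltr0n.
  have slE : s l = s k + (s j.+1 + delta).
    rewrite (sE k l j.+2); last by rewrite lE /k addSn !addnS addn0.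
    by congr (_ + _); rewrite /s -natr1 mulrDl mul1r.
  have sj0 : 0 < s j.+1 by rewrite /s mulr_gt0// ltr0n.
  have lT : s l + tau <= T.
    apply: le_trans (s_le ln); rewrite (sE l l.+1 1%N) ?addn1//.
    by rewrite lerD2l /s mul1r.
  have kl : s k + tau < s l by rewrite slE ltrD2l; lra.
  have := increment_moment_cross d0 mX pX dp ddp C0 alpha0 densQ p0 p1 p2
    gamma0 gammaalpha momoo hoo x sk0 tau0 kl lT.
  have VE u v : 0 <= u -> 0 <= v -> increment_moment X P h x u v = V u v.
    by move=> u0 v0; apply: eq_integral => w _; rewrite !YE.
  rewrite !VE ?addr_ge0 ?s0 ?(ltW tau0)// => /le_trans; apply.
  apply: leeD => //; rewrite lee_fin; apply: cross_constant_le => //.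
    by rewrite tau0.
  by rewrite -/(s j.+1) slE; lra.
- move=> i l /andP[il ln]; pose k := i.+1; rewrite -/k.
  pose j := (l - k)%N.
  have fin u v : 0 <= u < v -> v - u <= T -> (V u v < +oo)%E.
    by move=> uv vu; apply: le_lt_trans (V_le uv vu) _; rewrite ltry.
  have slE : s l = s k + s j by apply: sE; rewrite /j subnKC// ltnW.
  have sj0 : 0 < s j by rewrite /s mulr_gt0// ltr0n subn_gt0.
  have jT : s j <= T by apply: s_le; rewrite (leq_trans (leq_subr _ _))// ltnW.
  split; apply: fin; rewrite ?s0 ?addr_ge0 ?s0 ?(ltW tau0)//= slE.
  + by rewrite ltrDl.
  + by rewrite addrAC subrr add0r.
  + by rewrite ltrD2r ltrDl.
  + by rewrite [leLHS](_ : _ = s j)//; ring.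
Qed.

Let mS2 : measurable_fun setT (fun tw : R * Omega => S tw.1 tw.2).
Proof.
apply: measurable_sum => k; apply: measurable_funB; last first.
  exact: (measurableT_comp (mYt _) measurable_snd).
have mp : measurable_fun setT (fun tw : R * Omega => (k%:R * delta + tw.1, tw.2)).
  apply: measurable_fun_pair => //; apply: measurable_funD => //; exact: measurable_fst.
exact: (measurableT_comp mY2 mp).
Qed.

Let mS2E : measurable_fun setT (fun tw : R * Omega => (S tw.1 tw.2 ^+ 2)%:E).
Proof. by apply/measurable_EFinP; apply: measurable_funX; exact: mS2. Qed.

Let m0T : measurable (`[0, T]%classic : set (measurableTypeR R)). Proof. by []. Qed.
Let m0delta : measurable (`[0, delta]%classic : set (measurableTypeR R)). Proof. by []. Qed.

(* Almost every path is square integrable around its starting point, because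
   the increments from time 0 have bounded second moments. *)
Let path_integrable :
  {ae P x, forall w, mu.-integrable `[0, T] (fun t => (Y t w)%:E)}.
Proof.
pose k (tw : R * Omega) := ((Y tw.1 tw.2 - Y 0 tw.2) ^+ 2)%:E.
have mk : measurable_fun setT k.
  apply/measurable_EFinP; apply: measurable_funX; apply: measurable_funB => //.
  exact: (measurableT_comp (mYt 0) measurable_snd).
have k0 tw : (0 <= k tw)%E by rewrite lee_fin sqr_ge0.
pose I w := (\int[mu]_(t in `[0%R, T]) k (t, w))%E.
have mI : measurable_fun setT I by exact: (measurable_restricted_integral m0T mk k0).
have I0 w : (0 <= I w)%E by apply: integral_ge0.
have Ioo : (\int[P x]_w I w < +oo)%E.
  rewrite /I (restricted_tonelli m0T mk k0).
  apply: (@le_lt_trans _ _ (C * K * T `^ beta * (T - 0))%:E); last by rewrite ltry.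
  apply: integral_itv_le; first exact: ltW.
    apply: measurable_funTS.
    exact: (@measurable_fun_fubini_tonelli_F _ _ _ _ _ (P x) k).
  move=> t; rewrite in_itv/= => /andP[t0 tT]; apply/andP; split.
    by apply: integral_ge0.
  have [->|t0'] := eqVneq t 0.
    rewrite integral0_eq => [|w _]; last by rewrite /k/= subrr expr0n.
    by rewrite lee_fin mulr_ge0 ?powR_ge0// mulr_ge0.
  apply: le_trans (@V_le 0 t _ _) _; rewrite ?subr0//.
    by rewrite lexx lt_neqAle eq_sym t0'.
  rewrite lee_fin; apply: ler_wpM2l; first exact: mulr_ge0 C0 K0.
  by apply: ge0_ler_powR; rewrite ?nnegrE// ?(ltW beta0) ?(ltW T0).
have iI : (P x).-integrable setT I.
  apply/integrableP; split => //.
  by under eq_integral do rewrite gee0_abs//.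
have := integrable_ae measurableT iI.
apply: filterS => w /(_ Logic.I) Ifin.
apply/integrableP; split.
  by apply/measurable_EFinP; apply: measurable_funTS; exact: mYw.
apply: (@le_lt_trans _ _ (\int[mu]_(t in `[0%R, T]) ((1 + `|Y 0 w|)%:E + k (t, w)))%E).
  apply: ge0_le_integral => //.
  - apply: measurableT_comp => //; apply/measurable_EFinP.
    by apply: measurable_funTS; exact: mYw.
  - apply: emeasurable_funD => //; apply: measurable_funTS.
    have mp : measurable_fun setT (fun t : R => (t, w)) by exact: measurable_fun_pair.
    exact: (measurableT_comp mk mp).
  - move=> t _; rewrite /k/= -EFinD lee_fin.
    have := ler_normD (Y t w - Y 0 w) (Y 0 w); rewrite subrK.
    rewrite -[(_ - _) ^+ 2]real_normK ?num_real//.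
    set u := `|_ - _|; have := sqr_ge0 (u - 1); nra.
rewrite ge0_integralD//.
- have lebT : mu `[0, T]%classic = T%:E.
    by rewrite lebesgue_measure_itv/= lte_fin T0 sube0.
  apply: lte_add_pinfty; last by rewrite -(ge0_fin_numE (I0 w)).
  by rewrite integral_cst//= lebT -EFinM ltry.
- apply: measurable_funTS.
  have mp : measurable_fun setT (fun t : R => (t, w)) by exact: measurable_fun_pair.
  exact: (measurableT_comp mk mp).
Qed.

Let error w := integral_functional X h T w - integral_functional_sum X h T n w.

Let errorE w : error w =
  \int[mu]_(t in `[0, n%:R * delta]) Y t w -
  delta * \sum_(0 <= k < n) Y (k%:R * delta) w.
Proof.
rewrite /error /integral_functional /integral_functional_sum nd big_mkord.
congr (_ - _ * _).
  apply: eq_Rintegral => t; rewrite inE/= in_itv/= => /andP[t0 _].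
  by rewrite YE.
apply: eq_bigr => k _; rewrite YE; first by rewrite mulrA.
exact: mulr_ge0 (ler0n _ _) (ltW delta0).
Qed.

Let measurable_error : measurable_fun setT error.
Proof.
apply: (eq_measurable_fun (fun w => \int[mu]_(t in `[0, n%:R * delta]) Y t w -
  delta * \sum_(0 <= k < n) Y (k%:R * delta) w)) => [w _|]; first by rewrite errorE.
apply: measurable_funB; last first.
  by apply: measurable_funM => //; apply: measurable_sum => k; exact: mYt.
have mYE : measurable_fun setT (fun tw : R * Omega => (Y tw.1 tw.2)%:E).
  exact/measurable_EFinP.
rewrite /Rintegral nd.
have mpart (f : R * Omega -> \bar R) : measurable_fun setT f ->
    measurable_fun setT (fun w => \int[mu]_(t in `[0%R, T]) (f^\+ (t, w)))%E.
  move=> mf; apply: (measurable_restricted_integral m0T (measurable_funepos mf)).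
  by move=> tw; exact: funepos_ge0.
apply: (@measurableT_comp _ _ _ _ _ _ fine) => //.
apply: (eq_measurable_fun (fun w =>
  \int[mu]_(t in `[0%R, T]) ((fun tw => (Y tw.1 tw.2)%:E)^\+ (t, w)) -
  \int[mu]_(t in `[0%R, T]) ((fun tw => (- Y tw.1 tw.2)%:E)^\+ (t, w)))%E) => [w _|].
  rewrite [RHS]integralE; congr (_ - _)%E; apply: eq_integral => t _.
    by rewrite !funeposE.
  by rewrite funeposE funenegE EFinN.
apply: emeasurable_funB; apply: mpart => //.
by apply/measurable_EFinP; exact: measurableT_comp.
Qed.

(** Along a path, Jensen's inequality bounds the squared error by [delta] times
    the integral over the offsets [t] in [[0, delta]] of the square of the sum
    over the cells of the increments of [h (X)] from the grid point to offset [t].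
    By Tonelli it remains to bound the second moment of this sum for a fixed
    offset. *)
Lemma mean_square_error_le :
  (\int[P x]_w ((integral_functional X h T w -
     integral_functional_sum X h T n w) ^+ 2)%:E <= (delta ^+ 2 * (W * F))%:E)%E.
Proof.
apply: (@le_trans _ _ (\int[P x]_w (delta%:E *
    \int[mu]_(t in `[0%R, delta]) (S t w ^+ 2)%:E))%E).
  have mI := measurable_restricted_integral m0delta mS2E.
  have sq0 w t : (0 <= (S t w ^+ 2)%:E)%E by rewrite lee_fin sqr_ge0.
  apply: ae_ge0_le_integral => //.
  - by move=> w _; rewrite lee_fin sqr_ge0.
  - by apply/measurable_EFinP; apply: measurable_funX; exact: measurable_error.
  - move=> w _; rewrite mule_ge0 ?lee_fin ?(ltW delta0)//; exact: integral_ge0.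
  - apply: emeasurable_funM => //; apply: mI => tw; exact: sq0.
  - have := path_integrable; apply: filterS => w iw _.
    have iw' : mu.-integrable `[0, n%:R * delta] (EFin \o Y^~ w) by rewrite nd.
    have [iS E] := path_error_eq delta0 (mYw w) iw'.
    rewrite -/(error w) errorE E; apply: sqr_Rintegral_le => //.
    have mp : measurable_fun setT (fun t : R => (t, w)) by exact: measurable_fun_pair.
    exact: (measurableT_comp mS2 mp).
have sq0 (tw : R * Omega) : (0 <= (S tw.1 tw.2 ^+ 2)%:E)%E by rewrite lee_fin sqr_ge0.
rewrite ge0_integralZl_EFin//; last 3 first.
- by move=> w _; apply: integral_ge0 => t _; exact: (sq0 (t, w)).
- exact: (measurable_restricted_integral m0delta mS2E sq0).
- exact: ltW.
rewrite (restricted_tonelli m0delta mS2E sq0).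
have -> : (delta ^+ 2 * (W * F))%:E = (delta%:E * (W * F * (delta - 0))%:E)%E.
  by rewrite -EFinM; congr EFin; rewrite subr0; ring.
apply: lee_wpmul2l; first by rewrite lee_fin ltW.
apply: integral_itv_le; first exact: ltW.
  apply: measurable_funTS.
  exact: (@measurable_fun_fubini_tonelli_F _ _ _ _ _ (P x) _ mS2E sq0).
move=> t; rewrite in_itv/= => tdelta; apply/andP; split.
  by apply: integral_ge0 => w _; exact: (sq0 (t, w)).
exact: S_moment.
Qed.

End mean_square_error.

Theorem theorem1 (R : realType) (d : nat) (dO : measure_display)
  (Omega : measurableType dO)
  (X : R -> Omega -> 'rV[R]_d) (P : 'rV[R]_d -> probability Omega R)
  (p : R -> 'rV[R]_d -> 'rV[R]_d -> R)
  (T CT alpha gamma : R) (Q h : 'rV[R]_d -> R) :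
  (0 < d)%N ->
  markov_process X P ->
  transition_density X P p ->
  (forall t x y, 0 < t -> derivable (fun s => p s x y) t 1) ->
  (forall t x y, 0 < t -> derivable (derive1 (fun s => p s x y)) t 1) ->
  0 < T -> 1 <= CT ->
  0 < alpha <= 2 ->
  is_density Q ->
  (forall t x y, 0 < t <= T ->
    p t x y <=
      CT * t `^ (- (d%:R / alpha)) * Q (t `^ (- alpha^-1) *: (x - y))) ->
  (forall t x y, 0 < t <= T ->
    `| derive1 (fun s => p s x y) t | <=
      CT * t `^ (- 1 - d%:R / alpha) * Q (t `^ (- alpha^-1) *: (x - y))) ->
  (forall t x y, 0 < t <= T ->
    `| derive1n 2 (fun s => p s x y) t | <=
      CT * t `^ (- 2 - d%:R / alpha) * Q (t `^ (- alpha^-1) *: (x - y))) ->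
  0 < gamma <= alpha / 2 ->
  (moment Q (2 * gamma) < +oo)%E ->
  (holder_seminorm gamma h < +oo)%E ->
  forall x : 'rV[R]_d,
  (gamma != alpha / 2 -> forall n : nat, (1 <= n)%N ->
    ('E_(P x) [(fun w => `| integral_functional X h T w
                            - integral_functional_sum X h T n w | ^+ 2)%R] <=
     (D_const T gamma alpha Q CT * C_const gamma alpha
        * fine (holder_seminorm gamma h) ^+ 2
        * n%:R `^ (- (1 + 2 * gamma / alpha)))%:E)%E) /\
  (gamma = alpha / 2 -> forall n : nat, (2 <= n)%N ->
    ('E_(P x) [(fun w => `| integral_functional X h T w
                            - integral_functional_sum X h T n w | ^+ 2)%R] <=
     (D_const T gamma alpha Q CT
        * fine (holder_seminorm gamma h) ^+ 2
        * n%:R ^- 2 * ln n%:R)%:E)%E).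
Proof.
move=> d0 mX pX dp ddp T0 C1 /andP[alpha0 _] densQ p0 p1 p2 /andP[gamma0 gammaalpha].
move=> momoo hoo x.
set H := fine (holder_seminorm gamma h); set M := fine (moment Q (2 * gamma)).
set beta := 2 * gamma / alpha.
have beta0 : 0 < beta by rewrite divr_gt0// mulr_gt0.
have M0 : 0 <= M.
  rewrite fine_ge0//; apply: integral_ge0 => z _.
  by have [_ Q0 _] := densQ; rewrite lee_fin mulr_ge0 ?powR_ge0.
have scale0 : 0 <= CT ^+ 2 * T `^ (2 + beta) * M * H ^+ 2.
  by rewrite mulr_ge0 ?sqr_ge0// mulr_ge0// mulr_ge0 ?powR_ge0 ?sqr_ge0.
have error n : (0 < n)%N ->
    ('E_(P x) [(fun w => `| integral_functional X h T w
                            - integral_functional_sum X h T n w | ^+ 2)%R] <=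
     (CT ^+ 2 * T `^ (2 + beta) * M * H ^+ 2 * (n%:R `^ (- (2 + beta)) *
        (3 + 3 / 2 * variance_factor beta n.-1)))%:E)%E.
  move=> n0; have nR : 0 < n%:R :> R by rewrite ltr0n.
  have := mean_square_error_le d0 mX pX dp ddp T0 C1 alpha0 densQ p0 p1 p2
    gamma0 gammaalpha momoo hoo x n0.
  rewrite unlock -/beta -/H -/M => le_err.
  under eq_integral do rewrite real_normK ?num_real//.
  apply: le_trans le_err _; rewrite lee_fin le_eqVlt; apply/orP; left; apply/eqP.
  have -> : (T / n%:R) ^+ 2 = T `^ 2 * n%:R `^ (- 2).
    by rewrite powRN !powR_mulrn ?ltW// exprMn exprVn.
  have -> : (T / n%:R) `^ beta = T `^ beta * n%:R `^ (- beta).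
    by rewrite powRM ?invr_ge0 ?ltW// -(powR_inv1 (ltW nR)) -powRrM mulN1r.
  have -> : n%:R `^ (- (2 + beta)) = n%:R `^ (- 2) * n%:R `^ (- beta) :> R.
    by rewrite [- (2 + beta)]opprD powRD// (gt_eqF nR) implybT.
  rewrite [T `^ (2 + _)]powRD ?(gt_eqF T0) ?implybT//; ring.
split=> [gammaN|gammaE] n n1.
- have beta1 : beta < 1.
    rewrite ltr_pdivrMr// mul1r mulrC -ltr_pdivlMr//.
    by rewrite lt_neqAle gammaN.
  have nR : 0 < n%:R :> R by rewrite ltr0n.
  apply: le_trans (error n n1) _; rewrite lee_fin /D_const -/beta -/M.
  have CK : (1 - beta)^-1 * beta^-1 <= C_const gamma alpha by rewrite le_max lexx.
  rewrite [leRHS](_ : _ = CT ^+ 2 * T `^ (2 + beta) * M * H ^+ 2 *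
    (n%:R `^ (- (2 + beta)) * (8 * C_const gamma alpha * n%:R))); last first.
    have -> : n%:R `^ (- (1 + beta)) = n%:R `^ (- (2 + beta)) * n%:R :> R.
      rewrite -{3}(powRr1 (ltW nR)) -powRD ?(gt_eqF nR) ?implybT//.
      by congr (_ `^ _); ring.
    by ring.
  apply: ler_wpM2l => //; apply: ler_wpM2l; first exact: powR_ge0.
  apply: le_trans (variance_factor_lt1 _ n1) _; first by rewrite beta0.
  by rewrite ler_wpM2r// ler_wpM2l.
- have n0 : (0 < n)%N by exact: ltn_trans n1.
  have nR : 0 < n%:R :> R by rewrite ltr0n.
  have betaE : beta = 1 by rewrite /beta gammaE; field; rewrite gt_eqF.
  apply: le_trans (error n n0) _; rewrite lee_fin /D_const -/beta -/M betaE.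
  rewrite [leRHS](_ : _ = CT ^+ 2 * T `^ (2 + 1) * M * H ^+ 2 *
    (n%:R `^ (- (2 + 1)) * (8 * n%:R * ln n%:R))); last first.
    have -> : n%:R ^- 2 = n%:R `^ (- (2 + 1)) * n%:R :> R.
      rewrite -powR_mulrn ?ltW// -powRN -{3}(powRr1 (ltW nR)) -powRD ?(gt_eqF nR) ?implybT//.
      by congr (_ `^ _); ring.
    by ring.
  apply: ler_wpM2l; first by move: scale0; rewrite betaE.
  apply: ler_wpM2l; first exact: powR_ge0.
  exact: variance_factor_eq1.
Qed.
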